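(* Let $0<q<1$, and let $\mathcal G^{(n)}=\sum_{i,j\in\mathbb N}\mathcal G^{(n)}_{ij}\otimes e_{ij}$ $(n\in\mathbb Z)$ be the irreducible $(N,\Delta_N)$-corepresentations of $L^\infty(SU_q(2))$ described explicitly in the context, and let $\varphi_0$ be the invariant nsf weight on $L^\infty(\widetilde E_q(2))=B(\ell^2(\mathbb Z))\bar\otimes1\bar\otimes\mathcal L(\mathbb Z)\subseteq B(L^2(N))$. Then for all $m,n\in\mathbb Z$ and $i,j,k,l\in\mathbb N$, $$\varphi_0\big(\mathcal G^{(n)}_{ij}(\mathcal G^{(m)}_{kl})^*\big)=\delta_{mn}\delta_{ik}\delta_{jl}\,\frac1{q^{2n+2j}}.$$
   Context: Here $\mathbb N=\{0,1,2,\dots\}$, $\bar\otimes$ is the $\sigma$-weakly closed spatial tensor product, and nsf means normal semi-finite faithful. Fix $0<q<1$. Let $L^2(SU_q(2))=\ell^2(\mathbb N)\otimes\overline{\ell^2(\mathbb N)}\otimes\ell^2(\mathbb Z)$ and $b=(\sum_{k\ge0}q^ke_{kk})\otimes1\otimes S$ on it, $S$ the forward bilateral shift on $\ell^2(\mathbb Z)$; $L^\infty(SU_q(2))=B(\ell^2(\mathbb N))\bar\otimes1\bar\otimes\mathcal L(\mathbb Z)$ with $\mathcal L(\mathbb Z)$ generated by $S$. Let $L^2(N)=\ell^2(\mathbb Z)\otimes\overline{\ell^2(\mathbb N)}\otimes\ell^2(\mathbb Z)$, $v=S^*\otimes1\otimes1$ on $L^2(N)$ (so $v$ maps $e_n\otimes\cdots$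 to $e_{n-1}\otimes\cdots$), and $L_{0+}:L^2(SU_q(2))\to L^2(N)$, $L_{0+}(e_n\otimes\overline{e_m}\otimes e_k)=(q^{2n+2};q^2)_\infty^{1/2}e_n\otimes\overline{e_m}\otimes e_k$. Put $N=B(\ell^2(\mathbb N),\ell^2(\mathbb Z))\bar\otimes1\bar\otimes\mathcal L(\mathbb Z)\subseteq B(L^2(SU_q(2)),L^2(N))$. (This $N$ carries a right Galois co-object structure for $L^\infty(SU_q(2))$, whose reflected quantum group is Woronowicz' quantum group $L^\infty(\widetilde E_q(2))$.) Notation: $(x;q)_n=\prod_{k=0}^{n-1}(1-q^kx)$ for $n\in\mathbb N\cup\{\infty\}$; $p_n(x;c,0\mid q)={}_2\varphi_1(q^{-n},0;qc\mid q,qx)$ (Wall polynomial), ${}_2\varphi_1$ being Heine's basic hypergeometric function. For $0\le t\le s$ put $$\mathcal G_{ts}=q^{t(t-s)}\Big(\tfrac{(q^2;q^2)_s}{(q^2;q^2)_t}\Big)^{1/2}(q^2;q^2)_{s-t}^{-1}\,v^{s+t}L_{0+}b^{s-t}p_t(b^*b;q^{2(s-t)},0\mid q^2)\in N,$$ and for $0\le s\le t$ $$\mathcal G_{ts}=q^{s(s-t)}\Big(\tfrac{(q^2;q^2)_t}{(q^2;q^2)_s}\Big)^{1/2}(q^2;q^2)_{t-s}^{-1}\,v^{t+s}L_{0+}(-qb^* )^{t-s}p_s(b^*b;q^{2(t-s)},0\mid q^2)\in N.$$ Then $\mathcal G=\sum_{s,t}\mathcal G_{ts}\otimes e_{ts}\in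 N\bar\otimes B(\ell^2(\mathbb N))$ is unitary, and $\mathcal G^{(n)}=(v^n\otimes1)\mathcal G$, i.e. $\mathcal G^{(n)}_{ts}=v^n\mathcal G_{ts}$. $\varphi_0$ is the nsf weight on $B(\ell^2(\mathbb Z))\bar\otimes1\bar\otimes\mathcal L(\mathbb Z)$ determined by $\varphi_0(e_{ij}\otimes1\otimes S^k)=\delta_{ij}\delta_{k,0}q^{2i}$ for $i,j,k\in\mathbb Z$. *)

(* Defs.v *)
From HB Require Import structures.
From mathcomp Require Import all_boot all_order all_algebra.
From mathcomp Require Import ring lra complex.
From mathcomp Require Import all_classical all_reals all_analysis.

Set Implicit Arguments.
Unset Strict Implicit.
Unset Printing Implicit Defensive.

Import Order.TTheory GRing.Theory Num.Theory.
Import numFieldNormedType.Exports.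
Import Normc.

Local Open Scope classical_set_scope.
Local Open Scope complex_scope.
Local Open Scope ring_scope.

Section square_summable.
Context {R : realType}.

Definition enormsq (I : choiceType) (x : I -> R[i]) : \bar R :=
  \esum_(i in [set: I]) (normc (x i) ^+ 2)%:E.

Definition square_summable (I : choiceType) : {pred (I -> R[i])} :=
  fun x => (enormsq x < +oo)%E.

Lemma normc_ge0 (z : R[i]) : 0 <= normc z.
Proof. by case: z => a b; apply: sqrtr_ge0. Qed.

Lemma enormsq_ge0 (I : choiceType) (x : I -> R[i]) : (0 <= enormsq x)%E.
Proof. by apply: esum_ge0 => i _; rewrite lee_fin sqr_ge0. Qed.

Lemma esumZ_le (I : choiceType) (f : I -> \bar R) (c : R) :
  0 <= c -> (forall i, 0 <= f i)%E ->
  (\esum_(i in [set: I]) (c%:E * f i) <= c%:E * \esum_(i in [set: I]) f i)%E.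
Proof.
move=> c0 f0; apply: ge_ereal_sup => _ [X [finX _] <-].
rewrite -ge0_mule_fsumr//; apply: lee_wpmul2l; first by rewrite lee_fin.
by apply: esum_ge; exists X.
Qed.

Lemma sqrD_le (u w : R) : (u + w) ^+ 2 <= 2 * u ^+ 2 + 2 * w ^+ 2.
Proof. by have := sqr_ge0 (u - w); rewrite sqrrB sqrrD; lra. Qed.

Lemma enormsq_lin (I : choiceType) (a : R[i]) (x y : I -> R[i]) :
  (enormsq (fun i => a * x i + y i)%R <=
   (2 * normc a ^+ 2)%:E * enormsq x + 2%:E * enormsq y)%E.
Proof.
apply: (@le_trans _ _ (\esum_(i in [set: I])
   ((2 * normc a ^+ 2)%:E * (normc (x i) ^+ 2)%:E
    + 2%:E * (normc (y i) ^+ 2)%:E))%E).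
  apply: le_esum => i _; rewrite -!EFinM -EFinD lee_fin.
  apply: (@le_trans _ _ ((normc a * normc (x i) + normc (y i)) ^+ 2)).
    rewrite ler_sqr ?nnegrE ?normc_ge0 ?addr_ge0 ?mulr_ge0 ?normc_ge0//.
    by rewrite -normcM; apply: le_normcD.
  by rewrite -mulrA -exprMn; exact: sqrD_le.
rewrite esumD; first last.
- by move=> i _; rewrite -EFinM lee_fin mulr_ge0 ?sqr_ge0.
- by move=> i _; rewrite -EFinM lee_fin -mulrA -exprMn mulr_ge0 ?sqr_ge0.
apply: leeD; apply: esumZ_le => [|i]; rewrite ?lee_fin ?sqr_ge0//.
by rewrite mulr_ge0 ?sqr_ge0.
Qed.

Lemma square_summable_submod (I : choiceType) :
  submod_closed (@square_summable I).
Proof.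
split.
  rewrite unfold_in /enormsq esum1// => i _.
  by rewrite (_ : (0 : I -> R[i]) i = 0)// normc0 expr0n.
move=> a x y; rewrite !unfold_in => hx hy.
apply: le_lt_trans (enormsq_lin a x y) _.
apply: lte_add_pinfty; apply: lte_mul_pinfty => //.
by rewrite lee_fin mulr_ge0 ?sqr_ge0.
Qed.

HB.instance Definition _ (I : choiceType) := GRing.isSubmodClosed.Build _ _
  (@square_summable I) (@square_summable_submod I).

End square_summable.

Record ell2 (R : realType) (I : choiceType) := Ell2 {
  ell2_val :> I -> R[i];
  ell2P : ell2_val \in @square_summable R I }.

HB.instance Definition _ (R : realType) (I : choiceType) :=
  [isSub for @ell2_val R I].
HB.instance Definition _ (R : realType) (I : choiceType) :=
  [Choice of ell2 R I by <:].
HB.instance Definition _ (R : realType) (I : choiceType) :=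
  [SubChoice_isSubLmodule of ell2 R I by <:].

Section ell2_inner.
Context {R : realType}.

(* Unconditional sums of real and of complex families; they are only meaningful
   for absolutely summable families. *)
Definition rsum (I : choiceType) (f : I -> R) : R :=
  fine (\esum_(i in [set: I]) (f^\+ i)%:E)
  - fine (\esum_(i in [set: I]) (f^\- i)%:E).

Definition csum (I : choiceType) (f : I -> R[i]) : R[i] :=
  rsum (fun i => complex.Re (f i)) +i* rsum (fun i => complex.Im (f i)).

Definition normsq2 (I : choiceType) (x : ell2 R I) : R := fine (enormsq x).

Definition norm2 (I : choiceType) (x : ell2 R I) : R := Num.sqrt (normsq2 x).

(* linear in the first variable *)
Definition inner (I : choiceType) (x y : ell2 R I) : R[i] :=
  csum (fun i => x i * conjc (y i)).

Lemma enormsqE (I : choiceType) (x : ell2 R I) :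
  enormsq x = (normsq2 x)%:E.
Proof.
rewrite fineK// ge0_fin_numE ?enormsq_ge0//; exact: (ell2P x).
Qed.

Lemma normsq2_ge0 (I : choiceType) (x : ell2 R I) : 0 <= normsq2 x.
Proof. by rewrite -lee_fin -enormsqE enormsq_ge0. Qed.

Lemma norm2_ge0 (I : choiceType) (x : ell2 R I) : 0 <= norm2 x.
Proof. exact: sqrtr_ge0. Qed.

Lemma sqr_norm2 (I : choiceType) (x : ell2 R I) : norm2 x ^+ 2 = normsq2 x.
Proof. by rewrite sqr_sqrtr ?normsq2_ge0. Qed.

Lemma normsq2_lin (I : choiceType) (a : R[i]) (x y : ell2 R I) :
  normsq2 (a *: x + y) <= 2 * normc a ^+ 2 * normsq2 x + 2 * normsq2 y.
Proof. by rewrite -lee_fin EFinD !EFinM -!enormsqE -!EFinM enormsq_lin. Qed.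

(* the standard orthonormal basis *)
Lemma basis_subproof (I : choiceType) (i : I) :
  (fun j => (j == i)%:R) \in @square_summable R I.
Proof.
rewrite unfold_in /enormsq (@esumID _ _ [set i]); last first.
  by move=> j _; rewrite lee_fin sqr_ge0.
rewrite setTI esum_set1 ?lee_fin ?sqr_ge0//.
rewrite setTI esum1 ?adde0 ?ltry// => j /= /eqP/negbTE ->.
by rewrite normc0 expr0n.
Qed.

Definition basis (I : choiceType) (i : I) : ell2 R I := Ell2 (basis_subproof i).

End ell2_inner.

Section bounded_operator.
Context {R : realType}.

Definition bounded_linear (I J : choiceType) : {pred (ell2 R I -> ell2 R J)} :=
  fun T => `[< linear T /\
               exists M : R, forall x, norm2 (T x) <= M * norm2 x >].

Lemma norm2_boundP (I J : choiceType) (T : ell2 R I -> ell2 R J) :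
  (exists M : R, forall x, norm2 (T x) <= M * norm2 x) <->
  (exists2 M : R, 0 <= M & forall x, normsq2 (T x) <= M * normsq2 x).
Proof.
split=> [[M HM]|[M M0 HM]].
  exists (M ^+ 2); first exact: sqr_ge0.
  move=> x; rewrite -!sqr_norm2 -exprMn ler_sqr ?nnegrE ?norm2_ge0//.
  exact: le_trans (norm2_ge0 _) (HM x).
exists (Num.sqrt M) => x; rewrite -sqrtrM//; exact: ler_wsqrtr.
Qed.

Lemma bounded_linear_submod (I J : choiceType) :
  submod_closed (@bounded_linear I J).
Proof.
split.
  apply/asboolP; split=> [a x y|]; first by rewrite /= scaler0 addr0.
  apply/norm2_boundP; exists 0 => // x.
  rewrite mul0r -lee_fin -enormsqE /enormsq esum1// => i _.
  by rewrite (_ : (0 : ell2 R J) i = 0)// normc0 expr0n.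
move=> a S T /asboolP[linS /norm2_boundP[M M0 HM]].
move=> /asboolP[linT /norm2_boundP[N N0 HN]]; apply/asboolP; split.
  move=> c x y; rewrite !fctE linS linT !scalerDr !scalerA (mulrC a c).
  by rewrite addrACA.
apply/norm2_boundP; exists (2 * normc a ^+ 2 * M + 2 * N).
  by rewrite addr_ge0// mulr_ge0// mulr_ge0// sqr_ge0.
move=> x; apply: le_trans (normsq2_lin _ _ _) _.
rewrite [leRHS]mulrDl -(mulrA _ M) -(mulrA 2 N); apply: lerD.
  by rewrite ler_wpM2l// mulr_ge0 ?sqr_ge0.
by rewrite ler_wpM2l.
Qed.

HB.instance Definition _ (I J : choiceType) := GRing.isSubmodClosed.Build _ _
  (@bounded_linear I J) (@bounded_linear_submod I J).

End bounded_operator.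

Record bop (R : realType) (I J : choiceType) := Bop {
  bop_fun :> ell2 R I -> ell2 R J;
  bopP : bop_fun \in @bounded_linear R I J }.

HB.instance Definition _ (R : realType) (I J : choiceType) :=
  [isSub for @bop_fun R I J].
HB.instance Definition _ (R : realType) (I J : choiceType) :=
  [Choice of bop R I J by <:].
HB.instance Definition _ (R : realType) (I J : choiceType) :=
  [SubChoice_isSubLmodule of bop R I J by <:].

Section bop_theory.
Context {R : realType}.

Lemma bop_linear (I J : choiceType) (T : bop R I J) : linear T.
Proof. by have /asboolP[] := bopP T. Qed.

HB.instance Definition _ (I J : choiceType) (T : bop R I J) :=
  GRing.isLinear.Build _ _ _ _ T (bop_linear T).

Lemma opid_subproof (I : choiceType) :
  (fun x => x) \in @bounded_linear R I I.
Proof.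
by apply/asboolP; split=> //; exists 1 => x; rewrite mul1r.
Qed.

Definition opid (I : choiceType) : bop R I I := Bop (opid_subproof I).

Lemma opmul_subproof (I J K : choiceType) (S : bop R J K) (T : bop R I J) :
  (fun x => S (T x)) \in @bounded_linear R I K.
Proof.
apply/asboolP; split=> [a x y|]; first by rewrite !linearP.
have /asboolP[_ /norm2_boundP[M M0 HM]] := bopP S.
have /asboolP[_ /norm2_boundP[N N0 HN]] := bopP T.
apply/norm2_boundP; exists (M * N); first exact: mulr_ge0.
by move=> x; apply: le_trans (HM _) _; rewrite -mulrA ler_wpM2l.
Qed.

Definition opmul (I J K : choiceType) (S : bop R J K) (T : bop R I J) :
  bop R I K := Bop (opmul_subproof S T).

Local Notation "S \bo T" := (opmul S T) (at level 40, left associativity).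

Definition opexp (I : choiceType) (T : bop R I I) (n : nat) : bop R I I :=
  iter n (opmul T) (opid I).

Definition oppoly (I : choiceType) (p : {poly R}) (T : bop R I I) : bop R I I :=
  \sum_(k < size p) (p`_k)%:C *: opexp T k.

(* The adjoint exists by the Riesz representation theorem and is unique. *)
Definition is_adjoint (I J : choiceType) (T : bop R I J) (S : bop R J I) :=
  forall x y, inner (T x) y = inner x (S y).

Definition adj (I J : choiceType) (T : bop R I J) : bop R J I :=
  xget 0 [set S | is_adjoint T S].

(* only meaningful for a unitary U, whose inverse is adj U *)
Definition uexpz (I : choiceType) (U : bop R I I) (n : int) : bop R I I :=
  match n with
  | Posz k => opexp U k
  | Negz k => opexp (adj U) k.+1
  end.

Definition positive_op (I : choiceType) (T : bop R I I) : Prop :=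
  forall x, 0 <= inner (T x) x.

Definition wcomp_ok (I J : choiceType) (w : J -> R) (f : J -> I) : Prop :=
  (exists c : R, forall j, `|w j| <= c) /\
  (forall j j', w j != 0 -> w j' != 0 -> f j = f j' -> j = j').

Lemma wcomp_bound (I J : choiceType) (w : J -> R) (f : J -> I) (c : R) :
  (forall j, `|w j| <= c) ->
  (forall j j', w j != 0 -> w j' != 0 -> f j = f j' -> j = j') ->
  forall x : ell2 R I,
    (enormsq (fun j => (w j)%:C * x (f j))%R <= (c ^+ 2)%:E * enormsq x)%E.
Proof.
move=> wc finj x; pose D := [set j | w j != 0].
rewrite /enormsq (@esumID _ _ D); last by move=> j _; rewrite lee_fin sqr_ge0.
rewrite !setTI [X in (_ + X)%E]esum1 ?adde0; last first.
  by move=> j /= /negP; rewrite negbK => /eqP ->; rewrite mul0r normc0 expr0n.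
apply: (@le_trans _ _
    (\esum_(j in D) ((c ^+ 2)%:E * (normc (x (f j)) ^+ 2)%:E))%E).
  apply: le_esum => j _; rewrite -EFinM lee_fin normcM exprMn.
  rewrite ler_wpM2r ?sqr_ge0//= expr0n addr0 sqrtr_sqr -real_normK ?num_real//.
  by rewrite normr_id ler_sqr ?nnegrE// (le_trans _ (wc j)).
rewrite -(@esum_image _ _ _ D f (fun i => (c ^+ 2)%:E * (normc (x i) ^+ 2)%:E)%E);
  last by move=> j j'; rewrite !inE => hj hj'; exact: finj.
apply: le_trans (esumZ_le _ _); rewrite ?sqr_ge0//.
  rewrite [leRHS](@esumID _ _ (f @` D)).
    rewrite setTI leeDl// esum_ge0// => i _.
    by rewrite -EFinM lee_fin mulr_ge0 ?sqr_ge0.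
  by move=> i _; rewrite -EFinM lee_fin mulr_ge0 ?sqr_ge0.
by move=> i; rewrite lee_fin sqr_ge0.
Qed.

Lemma wcomp_ell2 (I J : choiceType) (w : J -> R) (f : J -> I)
    (h : wcomp_ok w f) (x : ell2 R I) :
  (fun j => (w j)%:C * x (f j)) \in @square_summable R J.
Proof.
have [[c wc] finj] := h; rewrite unfold_in.
apply: le_lt_trans (wcomp_bound wc finj x) _.
by rewrite enormsqE -EFinM ltry.
Qed.

Lemma wcomp_subproof (I J : choiceType) (w : J -> R) (f : J -> I)
    (h : wcomp_ok w f) :
  (fun x => Ell2 (wcomp_ell2 h x)) \in @bounded_linear R I J.
Proof.
apply/asboolP; split.
  by move=> a x y; apply/val_inj/funext => j /=; rewrite fctE /= mulrDr mulrCA.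
have [[c wc] finj] := h; apply/norm2_boundP; exists (c ^+ 2).
  exact: sqr_ge0.
move=> x; rewrite -lee_fin EFinM -!enormsqE; exact: wcomp_bound.
Qed.

(* (wcomp h x)_j = w_j x_{f j} *)
Definition wcomp (I J : choiceType) (w : J -> R) (f : J -> I)
  (h : wcomp_ok w f) : bop R I J := Bop (wcomp_subproof h).

Lemma esum_supp (I J : choiceType) (D : set J) (f : J -> I)
    (g : I -> \bar R) (h : J -> \bar R) :
  (forall j, h j = 0 \/ D j)%E -> (forall i, g i = 0 \/ (f @` D) i)%E ->
  (forall i, 0 <= g i)%E -> (forall j, 0 <= h j)%E ->
  (forall j, D j -> h j = g (f j)) -> set_inj D f ->
  \esum_(j in [set: J]) h j = \esum_(i in [set: I]) g i.
Proof.
move=> h0 g0 gge hge hg finj.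
rewrite (@esumID _ _ D)// (@esumID _ _ (f @` D) setT)// !setTI.
rewrite [X in (_ + X)%E]esum1; last by move=> j nDj; case: (h0 j).
rewrite [X in (_ = _ + X)%E]esum1; last by move=> i nDi; case: (g0 i).
by rewrite !adde0 esum_image//; exact: eq_esum.
Qed.

Lemma rsum_supp (I J : choiceType) (D : set J) (f : J -> I)
    (g : I -> R) (h : J -> R) :
  (forall j, h j = 0 \/ D j) -> (forall i, g i = 0 \/ (f @` D) i) ->
  (forall j, D j -> h j = g (f j)) -> set_inj D f -> rsum h = rsum g.
Proof.
move=> h0 g0 hg finj; congr (fine _ - fine _).
  apply: (esum_supp (D := D) (f := f)) => //.
  - by move=> j; case: (h0 j) => [hj|]; [left; rewrite /funrpos hj maxxx|right].
  - by move=> i; case: (g0 i) => [gi|]; [left; rewrite /funrpos gi maxxx|right].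
  - by move=> i; rewrite lee_fin le_max lexx orbT.
  - by move=> i; rewrite lee_fin le_max lexx orbT.
  - by move=> j Dj; rewrite /funrpos hg.
apply: (esum_supp (D := D) (f := f)) => //.
- by move=> j; case: (h0 j) => [hj|]; [left; rewrite /funrneg hj oppr0 maxxx|right].
- by move=> i; case: (g0 i) => [gi|]; [left; rewrite /funrneg gi oppr0 maxxx|right].
- by move=> i; rewrite lee_fin le_max lexx orbT.
- by move=> i; rewrite lee_fin le_max lexx orbT.
- by move=> j Dj; rewrite /funrneg hg.
Qed.

Lemma csum_supp (I J : choiceType) (D : set J) (f : J -> I)
    (g : I -> R[i]) (h : J -> R[i]) :
  (forall j, h j = 0 \/ D j) -> (forall i, g i = 0 \/ (f @` D) i) ->
  (forall j, D j -> h j = g (f j)) -> set_inj D f -> csum h = csum g.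
Proof.
move=> h0 g0 hg finj; rewrite /csum.
congr (_ +i* _); apply: (rsum_supp (D := D) (f := f)) => //.
- by move=> j; case: (h0 j) => [->|]; [left|right].
- by move=> i; case: (g0 i) => [->|]; [left|right].
- by move=> j Dj; rewrite hg.
- by move=> j; case: (h0 j) => [->|]; [left|right].
- by move=> i; case: (g0 i) => [->|]; [left|right].
- by move=> j Dj; rewrite hg.
Qed.

Lemma inner_basis (I : choiceType) (i : I) (y : ell2 R I) :
  inner (basis i) y = conjc (y i).
Proof.
rewrite /inner (@csum_supp unit I [set i] (fun=> tt) (fun=> conjc (y i))).
- rewrite /csum /rsum; case: (conjc (y i)) => a b /=.
  have E (F : unit -> \bar R) : (forall u, 0 <= F u)%E ->
      \esum_(u in [set: unit]) F u = F tt.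
    move=> F0; rewrite (_ : setT = [set tt]) ?esum_set1//.
    by apply/seteqP; split=> -[].
  rewrite !E; try by move=> u; rewrite lee_fin le_max lexx orbT.
  have P (c : R) : Num.max c 0 - Num.max (- c) 0 = c.
    case: (leP 0 c) => c0.
      by rewrite max_r ?subr0// oppr_le0.
    by rewrite max_l ?sub0r ?opprK// oppr_ge0 ltW.
  by rewrite /= /funrpos /funrneg !P.
- move=> j /=; case: eqP => [->|]; first by right.
  by rewrite mul0r; left.
- by case; right; exists i.
- by move=> j /= ->; rewrite eqxx mul1r.
- by move=> j j'; rewrite !inE => -> ->.
Qed.

Lemma is_adjoint_uniq (I J : choiceType) (T : bop R I J) (S S' : bop R J I) :
  is_adjoint T S -> is_adjoint T S' -> S = S'.
Proof.
move=> hS hS'; apply/val_inj/funext => y; apply/val_inj/funext => i /=.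
apply: (can_inj (@conjcK _)); rewrite -!inner_basis.
by rewrite -hS -hS'.
Qed.

Lemma adj_eq (I J : choiceType) (T : bop R I J) (S : bop R J I) :
  is_adjoint T S -> adj T = S.
Proof.
move=> hS; apply: is_adjoint_uniq (hS).
by rewrite /adj; case: xgetP => // /(_ S).
Qed.

Lemma adj_wcomp (I J : choiceType) (w : J -> R) (f : J -> I) (h : wcomp_ok w f)
    (w' : I -> R) (g : I -> J) (h' : wcomp_ok w' g) :
  (forall j, w j != 0 -> g (f j) = j /\ w' (f j) = w j) ->
  (forall i, w' i != 0 -> f (g i) = i /\ w (g i) = w' i) ->
  adj (wcomp h) = wcomp h'.
Proof.
move=> gf fg; apply: adj_eq => x y.
apply: (csum_supp (D := [set j | w j != 0]) (f := f)) => /=.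
- move=> j; case: (eqVneq (w j) 0) => [->|]; last by right.
  by left; rewrite !mul0r.
- move=> i; case: (eqVneq (w' i) 0) => [->|w'0].
    by left; rewrite mul0r rmorph0 mulr0.
  by right; have [fgi wg] := fg _ w'0; exists (g i); rewrite ?wg.
- move=> j wj; have [-> ->] := gf _ wj.
  by rewrite rmorphM/= oppr0 mulrCA mulrA.
- by have [_ finj] := h; move=> j j'; rewrite !inE; exact: finj.
Qed.

End bop_theory.

Notation "S \bo T" := (opmul S T) (at level 40, left associativity).

Section weights.
Context {R : realType}.

Definition lspan (V : lmodType R[i]) (A : set V) : set V :=
  [set v | exists n (c : 'I_n -> R[i]) (a : 'I_n -> V),
     (forall r, A (a r)) /\ v = \sum_r c r *: a r].

Definition commutant (I : choiceType) (A : set (bop R I I)) : set (bop R I I) :=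
  [set T | forall S, A S -> S \bo T = T \bo S].

Definition vN_generated (I : choiceType) (A : set (bop R I I)) :
    set (bop R I I) :=
  commutant (commutant (A `|` [set adj S | S in A])).

(* The sigma-weakly continuous functional sum_n < . x_n, y_n >. *)
Definition sqsum_seq (I : choiceType) (x : nat -> ell2 R I) : Prop :=
  (\esum_(n in [set: nat]) (normsq2 (x n))%:E < +oo)%E.

Definition sw_functional (I J : choiceType) (x : nat -> ell2 R I)
    (y : nat -> ell2 R J) (T : bop R I J) : R[i] :=
  csum (fun n => inner (T (x n)) (y n)).

Definition sw_closure (I J : choiceType) (A : set (bop R I J)) :
    set (bop R I J) :=
  [set T | forall r (x : 'I_r -> nat -> ell2 R I) (y : 'I_r -> nat -> ell2 R J),
     (forall s, sqsum_seq (x s)) -> (forall s, sqsum_seq (y s)) ->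
     forall e : R, 0 < e ->
     exists2 S, A S & forall s, normc (sw_functional (x s) (y s) (T - S)) < e].

Section weight.
Variables (I : choiceType) (M : set (bop R I I)) (phi : bop R I I -> \bar R).

Definition pos_part : set (bop R I I) := [set T | M T /\ positive_op T].

Definition op_le (S T : bop R I I) : Prop := positive_op (T - S).

Definition directed (D : set (bop R I I)) : Prop :=
  D !=set0 /\
  forall S T, D S -> D T -> exists2 U, D U & op_le S U /\ op_le T U.

Definition is_sup (D : set (bop R I I)) (T : bop R I I) : Prop :=
  (forall S, D S -> op_le S T) /\
  (forall U, pos_part U -> (forall S, D S -> op_le S U) -> op_le T U).

Definition finite_pos : set (bop R I I) :=
  [set T | pos_part T /\ (phi T < +oo)%E].

(* Only the values of phi on the positive part of M matter; with the convention
   0 * +oo = 0 of extended reals. *)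
Record nsf_weight : Prop := NsfWeight {
  weight_ge0 : forall T, pos_part T -> (0 <= phi T)%E;
  weightD : forall S T, pos_part S -> pos_part T ->
    phi (S + T) = (phi S + phi T)%E;
  weightZ : forall (a : R) T, 0 <= a -> pos_part T ->
    phi (a%:C *: T) = (a%:E * phi T)%E;
  weight_normal : forall D T, D `<=` pos_part -> directed D -> pos_part T ->
    is_sup D T -> phi T = ereal_sup [set phi S | S in D];
  weight_semifinite : M `<=` sw_closure (lspan finite_pos);
  weight_faithful : forall T, pos_part T -> phi T = 0%E -> T = 0 }.

(* T lies in the definition domain of phi, i.e. the span of the positive
   elements of finite weight, and the linear extension of phi to this domain
   takes the value c at T. *)
Definition weight_at (T : bop R I I) (c : R[i]) : Prop :=
  exists n (a : 'I_n -> R[i]) (P : 'I_n -> bop R I I),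
    [/\ forall r, finite_pos (P r), T = \sum_r a r *: P r &
        c = \sum_r a r * (fine (phi (P r)))%:C].

End weight.
End weights.

Section wall.
Context {R : realType}.

(* (a; q)_n and (a; q)_oo *)
Definition qpoch (a q : R) (n : nat) : R := \prod_(k < n) (1 - q ^+ k * a).

Definition qpoch_inf (a q : R) : R := limn (fun n => qpoch a q n).

(* Heine's series 2phi1(a, b; c | q, z) *)
Definition heine_term (a b c q z : R) (k : nat) : R :=
  qpoch a q k * qpoch b q k / (qpoch c q k * qpoch q q k) * z ^+ k.

Definition heine (a b c q z : R) : R := limn (series (heine_term a b c q z)).

(* The Wall polynomial p_n(x; c, 0 | q) = 2phi1(q^-n, 0; q c | q, q x), see
   horner_wall; its Heine series terminates since (q^-n; q)_k = 0 for k > n. *)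
Definition wall (n : nat) (c q : R) : {poly R} :=
  \poly_(k < n.+1) heine_term (q ^- n) 0 (q * c) q q k.

Lemma horner_wall (n : nat) (c q x : R) : q != 0 ->
  (wall n c q).[x] = heine (q ^- n) 0 (q * c) q (q * x).
Proof.
move=> q0; rewrite /heine /wall horner_poly.
have E k : heine_term (q ^- n) 0 (q * c) q q k * x ^+ k =
    heine_term (q ^- n) 0 (q * c) q (q * x) k.
  by rewrite /heine_term exprMn mulrA.
have Z k : (n < k)%N -> heine_term (q ^- n) 0 (q * c) q (q * x) k = 0.
  move=> nk; rewrite /heine_term /qpoch (bigD1 (Ordinal nk))//=.
  by rewrite divff ?expf_neq0// subrr !mul0r.
apply/esym/lim_near_cst => //; near=> N.
have nN : (n.+1 <= N)%N by near: N; exact: nbhs_infty_ge.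
rewrite /series/= -(subnKC nN) big_mkord big_split_ord/= [X in _ + X]big1.
  by rewrite addr0; apply: eq_bigr => k _; rewrite E.
by move=> k _; rewrite Z// leq_addr.
Unshelve. all: by end_near. Qed.

Lemma qpoch_inf_itv (a q : R) : 0 <= a <= 1 -> 0 <= q <= 1 ->
  0 <= qpoch_inf a q <= 1.
Proof.
move=> /andP[a0 a1] /andP[q0 q1].
have F k : 0 <= 1 - q ^+ k * a <= 1.
  rewrite subr_ge0 mulr_ile1 ?exprn_ge0 ?exprn_ile1//=.
  by rewrite lerBlDr lerDl mulr_ge0 ?exprn_ge0.
have P0 n : 0 <= qpoch a q n by apply: prodr_ge0 => k _; case/andP: (F k).
have P1 n : qpoch a q n <= 1 by apply: prodr_ile1 => k _.
have cv : cvgn (fun n => qpoch a q n).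
  apply: nonincreasing_is_cvgn.
    apply/nonincreasing_seqP => n; rewrite /qpoch big_ord_recr/=.
    by rewrite ler_piMr ?P0//; case/andP: (F n).
  by exists 0 => _ [n _ <-].
apply/andP; split.
  by apply: limr_ge => //; near=> n; exact: P0.
by apply: limr_le => //; near=> n; exact: P1.
Unshelve. all: by end_near. Qed.

End wall.

Section operators.
Context {R : realType}.

(* The basis vector e_n (x) conj(e_m) (x) e_k of L^2(SU_q(2)), resp. L^2(N), is
   indexed by the triple (n, m, k). *)
Definition idxSU : choiceType := (nat * nat * int)%type.
Definition idxN : choiceType := (int * nat * int)%type.

Notation BSU := (bop R idxSU idxSU).
Notation BN := (bop R idxN idxN).

(* S e_k = e_{k+1} *)
Lemma shift_ok : wcomp_ok (fun _ : int => 1 : R) (fun k => k - 1).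
Proof.
split; first by exists 1 => j; rewrite normr1.
by move=> j j' _ _ /addIr.
Qed.

Definition shift : bop R int int := wcomp shift_ok.

(* v (e_n (x) conj(e_m) (x) e_k) = e_{n-1} (x) conj(e_m) (x) e_k *)
Lemma v_ok : wcomp_ok (fun _ : idxN => 1 : R)
  (fun t : idxN => ((t.1.1 + 1, t.1.2, t.2) : idxN)).
Proof.
split; first by exists 1 => j; rewrite normr1.
by move=> [[n m] k] [[n' m'] k'] _ _ /= [] /addIr -> -> ->.
Qed.

Definition v : BN := wcomp v_ok.

(* munit i j maps e_j to e_i and the other basis vectors to 0. *)
Lemma munit_ok (i j : int) : wcomp_ok (fun n : int => (n == i)%:R : R) (fun=> j).
Proof.
split; first by exists 1 => n; case: eqP; rewrite ?normr1 ?normr0.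
by move=> n n' /=; rewrite !pnatr_eq0 !eqb0 !negbK => /eqP -> /eqP ->.
Qed.

Definition munit (i j : int) : bop R int int := wcomp (munit_ok i j).

(* T = x (x) 1 (x) y *)
Definition is_tensor (x y : bop R int int) (T : BN) : Prop :=
  forall n m k n' m' k',
    T (basis (n, m, k)) (n', m', k') =
    x (basis n) n' * (m' == m)%:R * y (basis k) k'.

(* e_ij (x) 1 (x) S^k, see munit_shift_tensor *)
Lemma munit_shift_ok (i j k : int) :
  wcomp_ok (fun t : idxN => (t.1.1 == i)%:R : R)
    (fun t => ((j, t.1.2, t.2 - k) : idxN)).
Proof.
split; first by exists 1 => t; case: eqP; rewrite ?normr1 ?normr0.
move=> [[n m] l] [[n' m'] l'] /=; rewrite !pnatr_eq0 !eqb0 !negbK.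
by move=> /eqP -> /eqP -> [] -> /addIr ->.
Qed.

Definition munit_shift (i j k : int) : BN := wcomp (munit_shift_ok i j k).

Lemma munit_shift_tensor (i j k : int) :
  is_tensor (munit i j) (uexpz shift k) (munit_shift i j k).
Proof.
have shiftX n l : opexp shift n (basis l) = basis (l + n%:Z) :> ell2 R int.
  elim: n => [|n IHn]; first by rewrite addr0.
  rewrite [LHS](_ : _ = shift (opexp shift n (basis l)))// IHn.
  apply/val_inj/funext => m /=; rewrite mul1r; congr (_%:R).
  by rewrite subr_eq -addrA -PoszD addn1.
have adj_ok : wcomp_ok (fun _ : int => 1 : R) (fun k => k + 1).
  split; first by exists 1 => l; rewrite normr1.
  by move=> l l' _ _ /addIr.
have adjE : adj shift = wcomp adj_ok.
  by apply: adj_wcomp => l _; rewrite ?addrK ?subrK.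
have adjX n l : opexp (adj shift) n (basis l) = basis (l - n%:Z) :> ell2 R int.
  elim: n => [|n IHn]; first by rewrite subr0.
  rewrite [LHS](_ : _ = adj shift (opexp (adj shift) n (basis l)))// IHn adjE.
  apply/val_inj/funext => m /=; rewrite mul1r; congr (_%:R).
  by rewrite -addn1 PoszD eq_sym -subr_eq eq_sym opprD addrA.
have powE l : uexpz shift k (basis l) = basis (l + k).
  case: k => n; first exact: shiftX.
  rewrite NegzE; exact: (adjX n.+1).
move=> n m l n' m' l'; rewrite powE /= !xpair_eqE (eq_sym j) subr_eq.
rewrite -!mulrA; congr (_ * _).
by rewrite -!natrM !mulnb andbA.
Qed.

Definition LZ : set (bop R int int) := vN_generated [set shift].

(* B(l^2(Z)) (x) 1 (x) L(Z) *)
Definition Linf_Eq2 : set BN :=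
  sw_closure (lspan [set T | exists x y, LZ y /\ is_tensor x y T]).

(* The nsf weights on B(l^2(Z)) (x) 1 (x) L(Z) with
   phi(e_ij (x) 1 (x) S^k) = delta_ij delta_k0 q^(2i). *)
Definition is_phi0 (q : R) (phi : BN -> \bar R) : Prop :=
  nsf_weight Linf_Eq2 phi /\
  forall i j k : int, weight_at Linf_Eq2 phi (munit_shift i j k)
    ((i == j)%:R * (k == 0)%:R * (q ^ (2 * i))%:C).

Section with_q.
Variables (q : R) (hq : 0 < q < 1).

Let q01 : 0 <= q <= 1.
Proof. by case/andP: hq => /ltW -> /ltW ->. Qed.

Lemma b_ok : wcomp_ok (fun t : idxSU => q ^+ t.1.1)
  (fun t => ((t.1.1, t.1.2, t.2 - 1) : idxSU)).
Proof.
case/andP: q01 => q0 q1; split.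
  by exists 1 => t; rewrite ger0_norm ?exprn_ge0// exprn_ile1.
by move=> [[n m] k] [[n' m'] k'] _ _ /= [] -> -> /addIr ->.
Qed.

Definition b : BSU := wcomp b_ok.

Lemma L0_ok : wcomp_ok
  (fun t : idxN => if t.1.1 is Posz n
    then Num.sqrt (qpoch_inf (q ^+ (2 * n + 2)) (q ^+ 2)) else 0)
  (fun t => ((`|t.1.1|%N, t.1.2, t.2) : idxSU)).
Proof.
case/andP: q01 => q0 q1; split.
  exists 1 => -[[[n|n] m] k] /=; last by rewrite normr0.
  rewrite ger0_norm ?sqrtr_ge0// -[leRHS]sqrtr1 ler_wsqrtr//.
  suff /andP[] : 0 <= qpoch_inf (q ^+ (2 * n + 2)) (q ^+ 2) <= 1 by [].
  by apply: qpoch_inf_itv; rewrite ?exprn_ge0 ?exprn_ile1.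
move=> [[[n|n] m] k] [[[n'|n'] m'] k'] /=; rewrite ?eqxx// => _ _.
by case=> -> -> ->.
Qed.

Definition L0 : bop R idxSU idxN := wcomp L0_ok.

Definition G (t s : nat) : bop R idxSU idxN :=
  let Q := q ^+ 2 in
  if (t <= s)%N then
    (q ^ (t%:Z * (t%:Z - s%:Z)) * Num.sqrt (qpoch Q Q s / qpoch Q Q t)
       / qpoch Q Q (s - t))%:C *:
    (opexp v (s + t) \bo L0 \bo opexp b (s - t)
       \bo oppoly (wall t (q ^+ (2 * (s - t))) Q) (adj b \bo b))
  else
    (q ^ (s%:Z * (s%:Z - t%:Z)) * Num.sqrt (qpoch Q Q t / qpoch Q Q s)
       / qpoch Q Q (t - s))%:C *:
    (opexp v (t + s) \bo L0 \bo opexp ((- q)%:C *: adj b) (t - s)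
       \bo oppoly (wall s (q ^+ (2 * (t - s))) Q) (adj b \bo b)).

Definition Gn (n : int) (i j : nat) : bop R idxSU idxN := uexpz v n \bo G i j.

End with_q.
End operators.

(* Main.v *)
Require Import Defs.
From mathcomp Require Import all_boot all_order all_algebra.
From mathcomp Require Import ring lra zify complex.
From mathcomp Require Import all_classical all_reals all_analysis.

(** [G^(n)_ij] is a weighted shift, sending [e_r (x) e_m (x) e_k] to
    [g_ij(r) e_(r-n-i-j) (x) e_m (x) e_(k+j-i)] with real coefficients
    [g_ij(r)]. Hence the product of [G^(n)_ij] and the adjoint of [G^(m)_kl] is
    an elementary tensor [x (x) 1 (x) S^d], with [x] supported on one diagonal.
    By polarization its weight is determined by the weights of positive
    operators [Z Z^*], and normality gives the latter as limits of the weights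
    of [Z P_N Z^*], where [P_N] projects onto the vectors with [r < N]; these
    are finite combinations of the [e_ij (x) 1 (x) S^k]. What remains is the sum
    of [g_ij(r) g_kl(r) q^(2r)] over [r], that is, the orthogonality of the Wall
    polynomials with respect to the weight [(p^(r+1);p)_oo p^((D+1)r)] at the
    points [p^r], [p = q^2]. The moments of this weight are [(p;p)_(D+m)], and
    the finite q-binomial theorem then gives the orthogonality. *)

Set Implicit Arguments.
Unset Strict Implicit.
Unset Printing Implicit Defensive.

Import Order.TTheory GRing.Theory Num.Theory.
Import numFieldNormedType.Exports.
Import Normc.

Local Open Scope complex_scope.
Local Open Scope ring_scope.

(** * Wall polynomials *)

Section qpochhammer.
Context {R : realType}.
Implicit Types a p : R.
Local Open Scope classical_set_scope.

Lemma qpoch0 a p : qpoch a p 0 = 1.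
Proof. by rewrite /qpoch big_ord0. Qed.

Lemma qpochSr a p n : qpoch a p n.+1 = qpoch a p n * (1 - p ^+ n * a).
Proof. by rewrite /qpoch big_ord_recr. Qed.

Lemma qpochD a p m n : qpoch a p (m + n) = qpoch a p m * qpoch (p ^+ m * a) p n.
Proof.
rewrite /qpoch big_split_ord/=; congr (_ * _); apply: eq_bigr => k _ /=.
by rewrite exprD; ring.
Qed.

Lemma qpochSl a p n : qpoch a p n.+1 = (1 - a) * qpoch (p * a) p n.
Proof. by rewrite -add1n qpochD qpochSr qpoch0 expr0 expr1 !mul1r. Qed.

Variables (p : R) (hp : 0 < p < 1).

Let p0 : 0 < p. Proof. by case/andP: hp. Qed.
Let p1 : p < 1. Proof. by case/andP: hp. Qed.

Lemma qpoch_gt0 j n : 0 < qpoch (p ^+ j.+1) p n.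
Proof.
apply: prodr_gt0 => k _; rewrite -exprD addnS subr_gt0.
by rewrite exprn_ilt1 ?ltW.
Qed.

(** The lower bound is the inequality prod (1 - x_k) >= 1 - sum x_k with the geometric sum
    evaluated. Its rate is uniform in [n], which is what forces (p^n;p)_oo to tend to 1. *)
Lemma qpoch_itv a n : 0 <= a <= 1 ->
  1 - a * (1 - p ^+ n) / (1 - p) <= qpoch a p n <= 1.
Proof.
move=> /andP[a0 a1]; elim: n => [|n /andP[IHl IHr]].
  by rewrite qpoch0 expr0 subrr mulr0 mul0r subr0 lexx.
have pn0 : 0 <= p ^+ n by rewrite exprn_ge0// ltW.
have pn1 : p ^+ n <= 1 by rewrite exprn_ile1// ltW.
have pna0 : 0 <= p ^+ n * a by rewrite mulr_ge0.
have pna1 : p ^+ n * a <= 1 by rewrite mulr_ile1.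
have P0 : 0 <= qpoch a p n.
  apply: prodr_ge0 => k _; rewrite subr_ge0.
  by rewrite mulr_ile1 ?exprn_ge0 ?exprn_ile1 ?(ltW p0) ?(ltW p1).
rewrite qpochSr; apply/andP; split; last by nra.
apply: (@le_trans _ _ (qpoch a p n - p ^+ n * a)); last by nra.
rewrite -lerBlDr opprK; apply: le_trans IHl; rewrite exprS.
rewrite [leLHS](_ : _ = 1 - a * (1 - p ^+ n) / (1 - p))//.
by field; rewrite subr_eq0 eq_sym lt_eqF.
Qed.

Lemma cvg_qpoch a : 0 <= a <= 1 -> qpoch a p n @[n --> \oo] --> qpoch_inf a p.
Proof.
move=> /andP[a0 a1].
have F k : 0 <= 1 - p ^+ k * a <= 1.
  rewrite subr_ge0 mulr_ile1 ?exprn_ge0 ?exprn_ile1 ?(ltW p0) ?(ltW p1)//=.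
  by rewrite lerBlDr lerDl mulr_ge0 ?exprn_ge0 ?(ltW p0).
have P0 n : 0 <= qpoch a p n by apply: prodr_ge0 => k _; case/andP: (F k).
suff : cvgn (fun n => qpoch a p n) by [].
apply: nonincreasing_is_cvgn; last by exists 0 => _ [n _ <-].
apply/nonincreasing_seqP => n; rewrite qpochSr.
by rewrite ler_piMr ?P0//; case/andP: (F n).
Qed.

Lemma qpoch_infS a : 0 <= a <= 1 ->
  qpoch_inf a p = (1 - a) * qpoch_inf (p * a) p.
Proof.
move=> /andP[a0 a1].
have pa : 0 <= p * a <= 1 by rewrite mulr_ge0 ?mulr_ile1// ltW.
have cv : qpoch a p n.+1 @[n --> \oo] --> (1 - a) * qpoch_inf (p * a) p.
  under eq_fun do rewrite qpochSl.
  by apply: cvgMl_tmp; exact: cvg_qpoch.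
have cv' : qpoch a p n.+1 @[n --> \oo] --> qpoch_inf a p.
  by rewrite (cvg_shiftS (fun n => qpoch a p n)); apply: cvg_qpoch; rewrite a0.
exact: (cvg_unique _ cv' cv).
Qed.

(** The factor with k = 0 vanishes. This is the starting value of the telescoping sum in
    [cvg_wall_moment]. *)
Lemma qpoch_inf1 : qpoch_inf 1 p = 0.
Proof. by rewrite qpoch_infS ?ler01 ?lexx// subrr mul0r. Qed.

Let powp n : 0 <= p ^+ n <= 1.
Proof. by rewrite exprn_ge0 ?exprn_ile1// ltW. Qed.

Lemma qpoch_inf_pow r : qpoch_inf (p ^+ r) p = (1 - p ^+ r) * qpoch_inf (p ^+ r.+1) p.
Proof. by rewrite qpoch_infS// -exprS. Qed.

Lemma cvg_qpoch_inf : qpoch_inf (p ^+ n) p @[n --> \oo] --> (1 : R).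
Proof.
have pcv : p ^+ n @[n --> \oo] --> (0 : R).
  by apply: cvg_expr; rewrite ger0_norm// ltW.
(* The left bound is that of [qpoch_itv] at a = p^n, with 1 - p^N replaced by 1 so that it survives
   the limit in N. *)
apply: (@squeeze_cvgr _ _ _ _ (fun n => 1 - p ^+ n / (1 - p)) (fun=> 1)).
- near=> n; apply/andP; split; last first.
    by have /andP[] := qpoch_inf_itv (powp n) (introT andP (conj (ltW p0) (ltW p1))).
  apply: limr_ge; first by apply: cvgP; exact: cvg_qpoch (powp n).
  near=> N; have /andP[h _] := qpoch_itv N (powp n); apply: le_trans h.
  rewrite lerB// ler_pM2r ?invr_gt0 ?subr_gt0//.
  by have /andP[? ?] := powp n; have /andP[? ?] := powp N; nra.
- have : 1 - p ^+ n / (1 - p) @[n --> \oo] --> 1 - 0 / (1 - p).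
    by apply: cvgB; [exact: cvg_cst|exact: cvgMr_tmp].
  by rewrite mul0r subr0.
- exact: cvg_cst.
Unshelve. all: by end_near. Qed.

(* [sum_r (p^{r+1};p)_oo z^r] at [z = p^{m+1}]; the case [m = 0] telescopes, and
   [F(p z) = (1 - z) F(z)] for this function of [z]. *)
Lemma cvg_wall_moment m :
  \sum_(r < N) qpoch_inf (p ^+ r.+1) p * p ^+ (m.+1 * r) @[N --> \oo]
    --> qpoch p p m.
Proof.
elim: m => [|m IHm].
  rewrite qpoch0 (_ : (fun N => _) = (fun N => qpoch_inf (p ^+ N) p)).
    exact: cvg_qpoch_inf.
  apply/funext; elim=> [|N IHN]; first by rewrite big_ord0 expr0 qpoch_inf1.
  rewrite big_ord_recr/= IHN qpoch_inf_pow mul1n; ring.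
rewrite qpochSr -exprSr mulrBr mulr1.
rewrite -cvg_shiftS /=; set A := (fun N : nat => _) in IHm.
rewrite (_ : (fun N => _) = (fun N => A N.+1 - A N * p ^+ m.+1)); last first.
  apply/funext => N; rewrite /A mulr_suml [in RHS]big_ord_recl big_ord_recl.
  rewrite !muln0 -addrA; congr (_ + _).
  rewrite -sumrB; apply: eq_bigr => r _.
  rewrite !lift0 (qpoch_inf_pow r.+1).
  by rewrite (mulSn m.+1) mulnS !exprD; ring.
apply: cvgB; first by rewrite (cvg_shiftS A).
exact: cvgMr_tmp.
Qed.

(** Integration of [f] against the masses (p^(r+1);p)_oo p^((D+1)r) at the points p^r, defined
    through the moments. Orthogonality thus becomes finite algebra, and convergence enters only in
    [cvg_wall_functional]. *)
Definition wall_functional (D : nat) (f : {poly R}) : R :=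
  \sum_(i < size f) f`_i * qpoch p p (D + i).

Lemma wall_functional_widen D (f : {poly R}) n : (size f <= n)%N ->
  wall_functional D f = \sum_(i < n) f`_i * qpoch p p (D + i).
Proof.
move=> fn; rewrite /wall_functional.
rewrite (big_ord_widen n (fun i => f`_i * qpoch p p (D + i)))//.
rewrite big_mkcond; apply: eq_bigr => i _; case: ifPn => // /negbTE.
by rewrite ltnNge => /negbFE h; rewrite nth_default ?mul0r.
Qed.

Lemma cvg_wall_functional D (f : {poly R}) :
  \sum_(r < N) qpoch_inf (p ^+ r.+1) p * p ^+ (D.+1 * r) * f.[p ^+ r]
    @[N --> \oo] --> wall_functional D f.
Proof.
rewrite (_ : (fun N => _) = (fun N => \sum_(i < size f) f`_i *
   \sum_(r < N) qpoch_inf (p ^+ r.+1) p * p ^+ ((D + i).+1 * r))).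
  apply: (cvg_big (op := +%R)) => [|i _]; first exact: add_continuous.
  apply: cvgMl_tmp; exact: cvg_wall_moment.
apply/funext => N; under [RHS]eq_bigr do rewrite mulr_sumr.
rewrite exchange_big; apply: eq_bigr => r _ /=.
rewrite horner_coef mulr_sumr; apply: eq_bigr => i _.
by rewrite -addSn mulnDl exprD (mulnC i) (exprM _ r); ring.
Qed.

Lemma wall_functional_sum D n (c : nat -> R) (g : nat -> {poly R}) :
  wall_functional D (\sum_(k < n) c k *: g k) =
  \sum_(k < n) c k * wall_functional D (g k).
Proof.
pose s := (\max_(k < n) size (g k))%N.
have sg (k : 'I_n) : (size (g k) <= s)%N by exact: (leq_bigmax k).
rewrite (@wall_functional_widen _ _ s); last first.
  apply: leq_trans (size_sum _ _ _) _; apply/bigmax_leqP => k _.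
  by rewrite (leq_trans (size_scale_leq _ _)).
under eq_bigr do rewrite coef_sum mulr_suml.
rewrite exchange_big; apply: eq_bigr => k _ /=.
rewrite (@wall_functional_widen _ _ s)// mulr_sumr; apply: eq_bigr => i _.
by rewrite coefZ mulrA.
Qed.

(** The finite q-binomial theorem, by induction on [n] with a Pascal-type rule: the coefficient of
    z^(k+1) for n+1 is the one for n, minus p^-(n+1) times the coefficient of z^k for n. *)
Lemma qbinomial n z :
  \sum_(k < n.+1) qpoch (p ^- n) p k / qpoch p p k * z ^+ k =
  \prod_(i < n) (1 - z * p ^- i.+1).
Proof.
have pn m : p ^+ m != 0 by rewrite expf_neq0 ?gt_eqF.
have Z m k : (m < k)%N -> qpoch (p ^- m) p k = 0.
  move=> mk; rewrite /qpoch (bigD1 (Ordinal mk))//=.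
  by rewrite divff// subrr mul0r.
elim: n => [|n IHn]; first by rewrite big_ord1 big_ord0 !qpoch0 invr1 !mulr1.
rewrite [in RHS]big_ord_recr/= -IHn mulrBr mulr1 [in RHS]mulr_suml.
(* The added term k = n+1 is zero, since (p^-n;p)_(n+1) contains the factor 1 - p^n p^-n. *)
rewrite [X in _ = X - _](_ : _ = \sum_(k < n.+2)
    qpoch (p ^- n) p k / qpoch p p k * z ^+ k); last first.
  by rewrite [RHS]big_ord_recr/= Z// !mul0r addr0.
rewrite big_ord_recl [X in _ = X - _]big_ord_recl /= !qpoch0 -addrA.
congr (_ + _); rewrite -sumrB; apply: eq_bigr => k _ /=.
rewrite /bump /= add1n qpochSl.
rewrite (_ : p * p ^- n.+1 = p ^- n); last by rewrite exprS; field; rewrite pn gt_eqF.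
rewrite !qpochSr !exprS.
have h1 : qpoch p p k != 0 by rewrite gt_eqF// (qpoch_gt0 0).
have h2 : 1 - p ^+ k * p != 0.
  by rewrite subr_eq0 eq_sym lt_eqF// -exprSr exprn_ilt1// ltW.
by field; rewrite h1 h2 pn gt_eqF.
Qed.

(** The case z = p^(j+1) of [qbinomial]. For j < n the factor i = j vanishes; for j = n the product
    read backwards is (p;p)_n. *)
Lemma qbinomial_pow n j : (j <= n)%N ->
  \sum_(k < n.+1) qpoch (p ^- n) p k / qpoch p p k * p ^+ (j.+1 * k) =
  (j == n)%:R * qpoch p p n.
Proof.
move=> jn; under eq_bigr do rewrite exprM.
have pn m : p ^+ m != 0 by rewrite expf_neq0 ?gt_eqF.
rewrite qbinomial; case: eqVneq => [->|jn'].
  rewrite mul1r /qpoch (reindex_inj rev_ord_inj)/=; apply: eq_bigr => i _.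
  rewrite subnSK// (_ : p ^+ n.+1 = p ^+ (n - i) * (p ^+ i * p)).
    by congr (1 - _); field; rewrite pn.
  by rewrite -exprSr -exprD; congr (_ ^+ _); have := ltn_ord i; lia.
have lt : (j < n)%N by rewrite ltn_neqAle jn' jn.
by rewrite (bigD1 (Ordinal lt))//= divff// subrr !mul0r.
Qed.

(** This is (p^(D+1) x;p)_m as a polynomial in x. At x = p^k it is the quotient of the moments
    (p;p)_(D+k+m) and (p;p)_(D+k). *)
Let hpoly D m : {poly R} := \prod_(i < m) (1 - (p ^+ (D.+1 + i)) *: 'X).

Lemma hpoly_spec D m : (size (hpoly D m) <= m.+1)%N /\
  (hpoly D m)`_m = \prod_(i < m) (- p ^+ (D.+1 + i)).
Proof.
rewrite /hpoly; elim: m => [|m [IHs IHc]].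
  by rewrite !big_ord0 size_polyC oner_eq0 coefC eqxx.
rewrite !big_ord_recr/=; move: IHs IHc; set h := \prod_(i < m) _ => IHs IHc; split.
  apply: leq_trans (size_polyMleq _ _) _.
  have : (size (1 - p ^+ (D.+1 + m) *: 'X)%R <= 2)%N.
    apply: leq_trans (size_polyD _ _) _; rewrite geq_max size_polyC oner_eq0/=.
    by rewrite size_polyN (leq_trans (size_scale_leq _ _))// size_polyX.
  move=> h2; rewrite -subn1 leq_subLR (leq_trans (leq_add IHs h2))//.
  by rewrite addn2.
rewrite mulrBr mulr1 -scalerAr coefB coefZ coefMX /= IHc nth_default//.
by rewrite mulrN sub0r mulrC.
Qed.

(** The moment (p;p)_(D+k+m) cancels the denominator (p^(D+1);p)_k of the k-th Wall coefficient and
    leaves (p;p)_D times [hpoly] at p^k. Expanding [hpoly] in powers of p^k reduces the sum over k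
    to [qbinomial_pow]. *)
Lemma wall_functional_X D n m : (m <= n)%N ->
  wall_functional D (wall n (p ^+ D) p * 'X^m) =
  (m == n)%:R * (qpoch p p D * qpoch p p n * \prod_(i < n) (- p ^+ (D.+1 + i))).
Proof.
move=> mn; rewrite /wall poly_def mulr_suml.
pose c k := heine_term (p ^- n) 0 (p * p ^+ D) p p k.
transitivity (wall_functional D (\sum_(k < n.+1) c k *: 'X^(k + m))).
  by congr wall_functional; apply: eq_bigr => k _; rewrite -scalerAl -exprD.
rewrite (wall_functional_sum _ _ c (fun k => 'X^(k + m))).
have LX i : wall_functional D 'X^i = qpoch p p (D + i).
  rewrite /wall_functional size_polyXn big_ord_recr/= coefXn eqxx mul1r big1 ?add0r//.
  by move=> k _; rewrite coefXn ltn_eqF ?mul0r.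
have [hs hc] := hpoly_spec D m.
transitivity (qpoch p p D * \sum_(k < n.+1) \sum_(j < m.+1) (hpoly D m)`_j *
   (qpoch (p ^- n) p k / qpoch p p k * p ^+ (j.+1 * k))).
  rewrite mulr_sumr; apply: eq_bigr => k _; rewrite LX /c /heine_term.
  rewrite (_ : qpoch 0 p k = 1); last first.
    by rewrite /qpoch big1// => i _; rewrite mulr0 subr0.
  rewrite addnA !qpochD -exprSr -exprS.
  rewrite (_ : qpoch (p ^+ (D + k) * p) p m = (hpoly D m).[p ^+ k]).
    rewrite (horner_coef_wide _ hs) mulr1 mulr_sumr mulr_sumr mulr_sumr.
    apply: eq_bigr => j _; rewrite mulSn exprD (mulnC j k) exprM.
    by field; rewrite !gt_eqF// ?(qpoch_gt0 0) ?qpoch_gt0.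
  rewrite /qpoch /hpoly horner_prod; apply: eq_bigr => i _.
  by rewrite !hornerE /= -exprD -exprSr -exprD; congr (1 - p ^+ _); lia.
(* The coefficients j < m of [hpoly] meet a vanishing sum because j < n; the top one, j = m,
   contributes only when m = n. *)
rewrite exchange_big/= big_ord_recr/= big1 ?add0r; last first.
  move=> j _; rewrite -mulr_sumr qbinomial_pow; last by rewrite (leq_trans (ltnW _) mn).
  by rewrite ltn_eqF ?mul0r ?mulr0// (leq_trans _ mn).
rewrite -mulr_sumr qbinomial_pow// hc; case: eqP => [->|]; last by rewrite !mul0r !mulr0.
by rewrite !mul1r; ring.
Qed.

Lemma size_wall n c : (size (wall n c p) <= n.+1)%N.
Proof. exact: size_poly. Qed.

(** In the monomial expansion of [f], the powers below n are annihilated by [wall_functional_X]. *)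
Lemma wall_functionalM D n (f : {poly R}) : (size f <= n.+1)%N ->
  wall_functional D (wall n (p ^+ D) p * f) =
  f`_n * (qpoch p p D * qpoch p p n * \prod_(i < n) (- p ^+ (D.+1 + i))).
Proof.
move=> fn; have -> : f = \sum_(i < n.+1) f`_i *: 'X^i.
  rewrite -poly_def; apply/polyP => i; rewrite coef_poly; case: ltnP => // h.
  by rewrite nth_default// (leq_trans fn).
rewrite mulr_sumr; under eq_bigr do rewrite -scalerAr.
rewrite (wall_functional_sum D n.+1 (fun k => f`_k) (fun k => wall n (p ^+ D) p * 'X^k)).
rewrite big_ord_recr/= big1 ?add0r ?wall_functional_X ?eqxx ?mul1r//.
  congr (_ * _); rewrite -(poly_def n.+1 (fun i => f`_i)).
  by rewrite coef_poly ltnSn.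
by move=> k _; rewrite wall_functional_X ?ltn_eqF ?mul0r ?mulr0// ltnW.
Qed.

(** By symmetry m <= n. If m < n, the polynomial of degree m has no x^n term; if m = n, the value is
    the leading Wall coefficient times the constant of [wall_functionalM]. *)
Lemma wall_orthogonal D m n :
  wall_functional D (wall m (p ^+ D) p * wall n (p ^+ D) p) =
  (m == n)%:R * (p ^+ (D.+1 * n) * qpoch p p D ^+ 2 * qpoch p p n
                 / qpoch p p (D + n)).
Proof.
wlog mn : m n / (m <= n)%N => [th|].
  case: (leqP m n) => [/th//|/ltnW/th].
  by rewrite mulrC eq_sym => ->; case: eqP => [->|]; rewrite ?mul0r.
rewrite mulrC wall_functionalM; last by rewrite (leq_trans (size_wall _ _)).
case: eqVneq => [->|mn']; last first.
  rewrite nth_default ?mul0r// (leq_trans (size_wall _ _))//.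
  by rewrite ltn_neqAle mn' mn.
rewrite mul1r /wall coef_poly ltnSn /heine_term.
have pn k : p ^+ k != 0 by rewrite expf_neq0 ?gt_eqF.
have -> : qpoch 0 p n = 1.
  by rewrite /qpoch big1// => i _; rewrite mulr0 subr0.
(* After reversing the first product, the factors match as (1 - p^-(i+1)) (- p^(D+1+i)) p = p^(D+1)
   (1 - p^(i+1)). *)
have E : qpoch (p ^- n) p n * (\prod_(i < n) (- p ^+ (D.+1 + i))) * p ^+ n =
    p ^+ (D.+1 * n) * qpoch p p n.
  rewrite {1}/qpoch (reindex_inj rev_ord_inj)/= -big_split/=.
  have powE (x : R) : x ^+ n = \prod_(i < n) x by rewrite prodr_const card_ord.
  rewrite [X in _ * X = _]powE exprM (powE (p ^+ D.+1)) /qpoch -!big_split/=.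
  apply: eq_bigr => i _.
  have -> : p ^+ n = p ^+ (n - i.+1) * p ^+ i * p.
    by rewrite -exprD -exprSr; congr (_ ^+ _); have := ltn_ord i; lia.
  by rewrite exprD; field; rewrite !pn gt_eqF.
rewrite qpochD -exprS -exprSr.
transitivity ((qpoch (p ^- n) p n * (\prod_(i < n) (- p ^+ (D.+1 + i))) * p ^+ n) *
   (qpoch p p D / qpoch (p ^+ D.+1) p n)).
  by field; rewrite !gt_eqF// ?(qpoch_gt0 0) ?qpoch_gt0.
by rewrite E; field; rewrite !gt_eqF// ?(qpoch_gt0 0) ?qpoch_gt0.
Qed.

End qpochhammer.

(** * Sums and inner products *)

Section sums.
Context {R : realType} {I : choiceType}.
Implicit Types (f g : I -> R) (h k : I -> R[i]).
Local Open Scope classical_set_scope.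

Definition rsummable f := (\esum_(i in [set: I]) `|f i|%:E < +oo)%E.
Definition csummable h := (\esum_(i in [set: I]) (normc (h i))%:E < +oo)%E.

(** The converse of [esumZ_le] is [esumZ_le] itself for the factor 1/c. *)
Lemma esumZ (u : I -> \bar R) (c : R) : 0 <= c -> (forall i, 0 <= u i)%E ->
  (\esum_(i in [set: I]) (c%:E * u i) = c%:E * \esum_(i in [set: I]) u i)%E.
Proof.
move=> c0 u0; apply/eqP; rewrite eq_le esumZ_le//=.
have [->|cn0] := eqVneq c 0.
  by rewrite mul0e esum_ge0// => i _; rewrite mul0e.
have cp : 0 < c by rewrite lt_neqAle eq_sym cn0.
rewrite muleC -lee_pdivlMr// muleC.
rewrite [leLHS](_ : _ = \esum_(i in [set: I]) ((c^-1)%:E * (c%:E * u i)))%E.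
  by apply: esumZ_le; rewrite ?invr_ge0// => i; rewrite mule_ge0.
by apply: eq_esum => i _; rewrite muleA -EFinM mulVf ?mul1e.
Qed.

Let pos f := \esum_(i in [set: I]) (f^\+ i)%:E.
Let neg f := \esum_(i in [set: I]) (f^\- i)%:E.

Let pos0 f i : (0 <= (f^\+ i)%:E)%E.
Proof. by rewrite lee_fin le_max lexx orbT. Qed.
Let neg0 f i : (0 <= (f^\- i)%:E)%E.
Proof. by rewrite lee_fin le_max lexx orbT. Qed.

Let absE f : (\esum_(i in [set: I]) `|f i|%:E = pos f + neg f)%E.
Proof.
rewrite -esumD//; apply: eq_esum => i _; rewrite -EFinD; congr _%:E.
rewrite /funrpos /funrneg; case: (ger0P (f i)) => fi;
  by rewrite /Order.max; do ! case: ifPn; rewrite -?leNgt; lra.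
Qed.

Let posneg_fin f : rsummable f -> pos f \is a fin_num /\ neg f \is a fin_num.
Proof.
have p0 : (0 <= pos f)%E by exact: esum_ge0.
have n0 : (0 <= neg f)%E by exact: esum_ge0.
rewrite /rsummable absE => h; rewrite !ge0_fin_numE//; split.
  by apply: le_lt_trans h; rewrite leeDl.
by apply: le_lt_trans h; rewrite leeDr.
Qed.

Lemma rsumD f g : rsummable f -> rsummable g ->
  rsum (fun i => f i + g i) = rsum f + rsum g.
Proof.
move=> sf sg.
have sfg : rsummable (fun i => f i + g i).
  apply: le_lt_trans (lte_add_pinfty sf sg).
  by rewrite -esumD//; apply: le_esum => i _; rewrite -EFinD lee_fin ler_normD.
have [[pf nf] [pg ng] [pfg nfg]] := And3 (posneg_fin sf) (posneg_fin sg) (posneg_fin sfg).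
pose fg i := f i + g i.
(* Positive and negative parts are not additive, but this rearrangement holds termwise with
   nonnegative terms; all six sums are finite, so it can be solved for [rsum]. *)
have E : (pos fg + neg f + neg g = neg fg + pos f + pos g)%E.
  rewrite -!esumD//; try by move=> i _; rewrite adde_ge0.
  apply: eq_esum => i _; rewrite -!EFinD; congr _%:E; rewrite /funrpos /funrneg /fg.
  by rewrite /Order.max; do ! case: ifPn; rewrite -?leNgt; lra.
have := congr1 fine E; rewrite !fineD ?fin_numD ?pf ?nf ?pg ?ng ?pfg ?nfg//.
by rewrite /rsum -/(pos _) -/(neg _) -/(pos f) -/(pos g) -/(neg f) -/(neg g); lra.
Qed.

Lemma rsumN f : rsum (fun i => - f i) = - rsum f.
Proof.
rewrite /rsum opprB; congr (fine _ - fine _); apply: eq_esum => i _ //.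
by rewrite /funrneg /funrpos opprK.
Qed.

Lemma rsumZ c f : rsum (fun i => c * f i) = c * rsum f.
Proof.
wlog c0 : c / 0 <= c => [th|].
  case: (leP 0 c) => [/th//|c0]; rewrite -[c]opprK mulNr -th ?oppr_ge0 ?ltW//.
  by rewrite -rsumN; congr rsum; apply/funext => i; rewrite mulNr.
rewrite /rsum.
have -> : \esum_(i in [set: I]) ((fun i => c * f i)^\+ i)%:E = (c%:E * pos f)%E.
  rewrite -esumZ//; apply: eq_esum => i _; rewrite -EFinM /funrpos.
  by rewrite maxr_pMr// mulr0.
have -> : \esum_(i in [set: I]) ((fun i => c * f i)^\- i)%:E = (c%:E * neg f)%E.
  rewrite -esumZ//; apply: eq_esum => i _; rewrite -EFinM /funrneg.
  by rewrite maxr_pMr// mulr0 mulrN.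
(* For infinite [x] both sides are 0, as [fine] sends infinities to 0 and 0 times infinity is 0. *)
have fM (x : \bar R) : fine (c%:E * x) = c * fine x.
  have [->|cn0] := eqVneq c 0; first by rewrite mul0e mul0r.
  have cp : (0 < c%:E)%E by rewrite lte_fin lt_neqAle eq_sym cn0.
  by case: x => [r| |] //=; rewrite ?gt0_muley ?gt0_muleNy//= mulr0.
by rewrite !fM mulrBr.
Qed.

Lemma norm_rsum f : rsummable f ->
  `|rsum f| <= fine (\esum_(i in [set: I]) `|f i|%:E).
Proof.
move=> sf; have [pf nf] := posneg_fin sf.
rewrite absE fineD// /rsum -/(pos f) -/(neg f).
have : 0 <= fine (pos f) by apply: fine_ge0; exact: esum_ge0.
have : 0 <= fine (neg f) by apply: fine_ge0; exact: esum_ge0.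
by move=> ? ?; apply/ler_normlP; split; lra.
Qed.

Lemma rsum_ge0 f : (forall i, 0 <= f i) ->
  rsum f = fine (\esum_(i in [set: I]) (f i)%:E).
Proof.
move=> f0; rewrite /rsum [X in _ - fine X]esum1 ?subr0.
  by congr fine; apply: eq_esum => i _; rewrite /funrpos max_l.
by move=> i _; rewrite /funrneg max_r// oppr_le0.
Qed.

Lemma normc_Re (z : R[i]) : `|complex.Re z| <= normc z.
Proof.
case: z => a b /=; rewrite -sqrtr_sqr ler_wsqrtr// lerDl sqr_ge0//.
Qed.

Lemma normc_Im (z : R[i]) : `|complex.Im z| <= normc z.
Proof.
case: z => a b /=; rewrite -sqrtr_sqr ler_wsqrtr// lerDr sqr_ge0//.
Qed.

Lemma normc_ReIm (z : R[i]) : normc z <= `|complex.Re z| + `|complex.Im z|.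
Proof.
case: z => a b /=; rewrite -[leRHS]ger0_norm ?addr_ge0// -sqrtr_sqr.
rewrite ler_wsqrtr// -(real_normK (num_real a)) -(real_normK (num_real b)).
by rewrite sqrrD lerD2r lerDl mulrn_wge0// mulr_ge0.
Qed.

Lemma csummable_Re h : csummable h -> rsummable (fun i => complex.Re (h i)).
Proof.
by apply: le_lt_trans; apply: le_esum => i _; rewrite lee_fin normc_Re.
Qed.

Lemma csummable_Im h : csummable h -> rsummable (fun i => complex.Im (h i)).
Proof.
by apply: le_lt_trans; apply: le_esum => i _; rewrite lee_fin normc_Im.
Qed.

Lemma csumD h k : csummable h -> csummable k ->
  csum (fun i => h i + k i) = csum h + csum k.
Proof.
move=> sh sk; rewrite /csum.
under eq_fun do rewrite raddfD.
under [in X in _ +i* X]eq_fun do rewrite raddfD.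
rewrite !rsumD//; [exact: csummable_Im..|exact: csummable_Re|exact: csummable_Re].
Qed.

Lemma csumZ a h : csummable h -> csum (fun i => a * h i) = a * csum h.
Proof.
move=> sh; case: a => a b; rewrite /csum.
have sR := csummable_Re sh; have sI := csummable_Im sh.
have sZ c (f : I -> R) : rsummable f -> rsummable (fun i => c * f i).
  move=> sf; rewrite /rsummable; under eq_esum do rewrite normrM EFinM.
  by rewrite esumZ// lte_mul_pinfty.
rewrite (_ : (fun i => complex.Re _) =
    fun i => a * complex.Re (h i) + (- b) * complex.Im (h i)); last first.
  by apply/funext => i; case: (h i) => u v /=; rewrite mulNr.
rewrite (_ : (fun i => complex.Im (_ * _)) =
    fun i => a * complex.Im (h i) + b * complex.Re (h i)); last first.
  by apply/funext => i; case: (h i) => u v /=.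
rewrite !rsumD ?rsumZ; try exact: sZ.
by apply/eqP; rewrite eq_complex/= mulNr !eqxx.
Qed.

Lemma csum_conj h : csum (fun i => conjc (h i)) = conjc (csum h).
Proof.
rewrite /csum /=; congr (_ +i* _).
  by congr rsum; apply/funext => i; case: (h i).
by rewrite -rsumN; congr rsum; apply/funext => i; case: (h i).
Qed.

(** The factor 2 comes from bounding the real and imaginary parts separately. *)
Lemma normc_csum h : csummable h ->
  normc (csum h) <= 2 * fine (\esum_(i in [set: I]) (normc (h i))%:E).
Proof.
move=> sh; apply: le_trans (normc_ReIm _) _ => /=.
have le f : (forall i, `|f i| <= normc (h i)) ->
    `|rsum f| <= fine (\esum_(i in [set: I]) (normc (h i))%:E).
  move=> fh; have lt : (\esum_(i in [set: I]) `|f i|%:E <=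
      \esum_(i in [set: I]) (normc (h i))%:E)%E.
    by apply: le_esum => i _; rewrite lee_fin.
  have sf : rsummable f by exact: le_lt_trans sh.
  apply: le_trans (norm_rsum sf) _; apply: fine_le => //; rewrite ge0_fin_numE//;
    apply: esum_ge0 => i _; rewrite lee_fin// normc_ge0//.
have := le _ (fun i => normc_Re (h i)); have := le _ (fun i => normc_Im (h i)).
lra.
Qed.

End sums.

(** * Sesquilinearity of the inner product and quadratic forms *)

Section inner_product.
Context {R : realType}.
Local Open Scope classical_set_scope.

Lemma ell2DE (I : choiceType) (x y : ell2 R I) i : (x + y) i = x i + y i.
Proof. by []. Qed.

Lemma ell2ZE (I : choiceType) a (x : ell2 R I) i : (a *: x) i = a * x i.
Proof. by []. Qed.

Lemma normc_conj (z : R[i]) : normc (conjc z) = normc z.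
Proof. by case: z => a b /=; rewrite sqrrN. Qed.

(** A crude substitute for Cauchy-Schwarz, from s t <= s^2 + t^2 in each coordinate; it provides
    absolute convergence. *)
Lemma normc_inner_le (I : choiceType) (x y : ell2 R I) :
  (\esum_(i in [set: I]) (normc (x i * conjc (y i)))%:E
   <= (normsq2 x + normsq2 y)%:E)%E.
Proof.
rewrite EFinD -!enormsqE /enormsq -esumD; try by move=> i _; rewrite lee_fin sqr_ge0.
apply: le_esum => i _; rewrite -EFinD lee_fin normcM normc_conj.
have := normc_ge0 (x i); have := normc_ge0 (y i); nra.
Qed.

Lemma csummable_inner (I : choiceType) (x y : ell2 R I) :
  csummable (fun i => x i * conjc (y i)).
Proof. exact: le_lt_trans (normc_inner_le x y) (ltry _). Qed.

Lemma normc_inner (I : choiceType) (x y : ell2 R I) :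
  normc (inner x y) <= 2 * (normsq2 x + normsq2 y).
Proof.
apply: le_trans (normc_csum (csummable_inner x y)) _.
rewrite ler_pM2l// -lee_fin fineK; first exact: normc_inner_le.
rewrite ge0_fin_numE; first exact: csummable_inner.
by apply: esum_ge0 => i _; rewrite lee_fin normc_ge0.
Qed.

Lemma innerDl (I : choiceType) (x y z : ell2 R I) :
  inner (x + y) z = inner x z + inner y z.
Proof.
rewrite /inner -csumD; try exact: csummable_inner.
by congr csum; apply/funext => i; rewrite ell2DE mulrDl.
Qed.

Lemma innerZl (I : choiceType) a (x z : ell2 R I) :
  inner (a *: x) z = a * inner x z.
Proof.
rewrite /inner -csumZ; try exact: csummable_inner.
by congr csum; apply/funext => i; rewrite ell2ZE mulrA.
Qed.

Lemma inner_conj (I : choiceType) (x y : ell2 R I) :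
  inner y x = conjc (inner x y).
Proof.
rewrite /inner -csum_conj; congr csum; apply/funext => i.
by rewrite rmorphM/= conjcK mulrC.
Qed.

Lemma innerDr (I : choiceType) (x y z : ell2 R I) :
  inner z (x + y) = inner z x + inner z y.
Proof. by rewrite !(inner_conj _ z) innerDl rmorphD. Qed.

Lemma innerZr (I : choiceType) a (x z : ell2 R I) :
  inner z (a *: x) = conjc a * inner z x.
Proof. by rewrite !(inner_conj _ z) innerZl rmorphM. Qed.

Lemma inner0l (I : choiceType) (z : ell2 R I) : inner 0 z = 0.
Proof. by rewrite -(scale0r 0) innerZl mul0r. Qed.

Lemma innerNl (I : choiceType) (x z : ell2 R I) : inner (- x) z = - inner x z.
Proof. by rewrite -scaleN1r innerZl mulN1r. Qed.

Lemma innerBl (I : choiceType) (x y z : ell2 R I) :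
  inner (x - y) z = inner x z - inner y z.
Proof. by rewrite innerDl innerNl. Qed.

Lemma inner_suml (I : choiceType) n (x : 'I_n -> ell2 R I) (z : ell2 R I) :
  inner (\sum_r x r) z = \sum_r inner (x r) z.
Proof.
by elim/big_rec2: _ => [|r u v _ <-]; rewrite ?inner0l ?innerDl.
Qed.

Lemma innerxx (I : choiceType) (x : ell2 R I) : inner x x = (normsq2 x)%:C.
Proof.
rewrite /inner /csum; apply/eqP; rewrite eq_complex/=; apply/andP; split; apply/eqP.
  rewrite rsum_ge0.
    rewrite /normsq2 /enormsq; congr fine; apply: eq_esum => i _; congr _%:E.
    case: (x i) => a b /=; rewrite sqr_sqrtr ?addr_ge0 ?sqr_ge0//; ring.
  by move=> i; case: (x i) => a b /=; nra.
rewrite [X in rsum X](_ : _ = fun i => 0 * (0 : R)); first by rewrite rsumZ mul0r.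
by apply/funext => i; case: (x i) => a b /=; ring.
Qed.

Lemma inner_basisr (I : choiceType) (i : I) (y : ell2 R I) :
  inner y (Defs.basis i) = y i.
Proof. by rewrite inner_conj inner_basis conjcK. Qed.

Lemma bopDE (I J : choiceType) (S T : bop R I J) x : (S + T) x = S x + T x.
Proof. by []. Qed.

Lemma bopZE (I J : choiceType) a (T : bop R I J) x : (a *: T) x = a *: T x.
Proof. by []. Qed.

Lemma bopNE (I J : choiceType) (T : bop R I J) x : (- T) x = - T x.
Proof. by []. Qed.

Lemma bop_sumE (I J : choiceType) n (T : 'I_n -> bop R I J) x :
  (\sum_r T r) x = \sum_r T r x.
Proof. exact: (big_morph (fun S : bop R I J => S x)). Qed.

Lemma bop_ext (I J : choiceType) (S T : bop R I J) :
  (forall x j, S x j = T x j) -> S = T.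
Proof. by move=> ST; apply/val_inj/funext => x; apply/val_inj/funext; exact: ST. Qed.

(** Evaluating the form at x + y and at x + i y, with y a basis vector, isolates the coordinate <Q
    x, y> of Q x. *)
Lemma quadratic_form_eq0 (I : choiceType) (Q : bop R I I) :
  (forall x, inner (Q x) x = 0) -> Q = 0.
Proof.
move=> Q0; apply: bop_ext => x j; pose y := Defs.basis j : ell2 R I.
have A : inner (Q x) y + inner (Q y) x = 0.
  have := Q0 (x + y); rewrite linearD innerDl !innerDr !Q0 addr0 add0r.
  by [].
have B : - 'i%C * inner (Q x) y + 'i%C * inner (Q y) x = 0.
  have := Q0 (x + 'i%C *: y); rewrite linearD linearZ innerDl !innerDr !innerZl.
  rewrite !innerZr !Q0 !mulr0 addr0 add0r.
  have -> : conjc 'i%C = - 'i%C :> R[i] by apply/eqP; rewrite eq_complex/= oppr0 !eqxx.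
  by [].
have : inner (Q x) y = 0.
  have : 2 * 'i%C * inner (Q x) y = 0 :> R[i].
    transitivity ('i%C * (inner (Q x) y + inner (Q y) x)
      - (- 'i%C * inner (Q x) y + 'i%C * inner (Q y) x)); first by ring.
    by rewrite A B mulr0 subr0.
  have i0 : 'i%C != 0 :> R[i] by rewrite eq_complex/= oner_eq0 andbF.
  by move=> /eqP; rewrite !mulf_eq0 pnatr_eq0 (negbTE i0) => /eqP.
by rewrite inner_basisr.
Qed.

End inner_product.

(** * Weights *)

Section sigma_weak_closure.
Context {R : realType} {I J : choiceType}.
Implicit Types (S T : bop R I J) (A : set (bop R I J)).
Local Open Scope classical_set_scope.

Lemma bop_bound T :
  exists2 M : R, 0 <= M & forall x, normsq2 (T x) <= M * normsq2 x.
Proof. by have /asboolP[_ /norm2_boundP] := bopP T. Qed.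

Lemma csummable_sw (x : nat -> ell2 R I) (y : nat -> ell2 R J) T :
  sqsum_seq x -> sqsum_seq y -> csummable (fun n => inner (T (x n)) (y n)).
Proof.
move=> sx sy; have [M M0 HM] := bop_bound T; rewrite /csummable.
apply: (@le_lt_trans _ _ (\esum_(n in [set: nat])
    ((2 * M)%:E * (normsq2 (x n))%:E + 2%:E * (normsq2 (y n))%:E))%E).
  apply: le_esum => n _; rewrite -!EFinM -EFinD lee_fin.
  apply: le_trans (normc_inner _ _) _; rewrite mulrDr lerD2r -mulrA.
  by rewrite ler_pM2l// HM.
rewrite esumD; first last.
- by move=> n _; rewrite mule_ge0// lee_fin normsq2_ge0.
- by move=> n _; rewrite mule_ge0// lee_fin ?normsq2_ge0 ?mulr_ge0.
rewrite !esumZ ?mulr_ge0//; try by move=> n; rewrite lee_fin normsq2_ge0.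
by rewrite lte_add_pinfty// lte_mul_pinfty// lee_fin mulr_ge0.
Qed.

Lemma sw_functionalD (x : nat -> ell2 R I) (y : nat -> ell2 R J) S T :
  sqsum_seq x -> sqsum_seq y ->
  sw_functional x y (S + T) = sw_functional x y S + sw_functional x y T.
Proof.
move=> sx sy; rewrite /sw_functional -csumD; try exact: csummable_sw.
by congr csum; apply/funext => n; rewrite bopDE innerDl.
Qed.

Lemma sw_functionalZ (x : nat -> ell2 R I) (y : nat -> ell2 R J) a T :
  sqsum_seq x -> sqsum_seq y ->
  sw_functional x y (a *: T) = a * sw_functional x y T.
Proof.
move=> sx sy; rewrite /sw_functional -csumZ; try exact: csummable_sw.
by congr csum; apply/funext => n; rewrite bopZE innerZl.
Qed.

Lemma sub_sw_closure A : A `<=` sw_closure A.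
Proof.
move=> T AT r x y sx sy e e0; exists T => // s.
have -> : T - T = (0 : R[i]) *: T by rewrite subrr scale0r.
by rewrite sw_functionalZ// mul0r normc0.
Qed.

Lemma sw_closureD A S T : (forall S T, A S -> A T -> A (S + T)) ->
  sw_closure A S -> sw_closure A T -> sw_closure A (S + T).
Proof.
move=> AD cS cT r x y sx sy e e0.
have e2 : 0 < e / 2 by rewrite divr_gt0.
have [S' AS' HS] := cS r x y sx sy _ e2.
have [T' AT' HT] := cT r x y sx sy _ e2.
exists (S' + T'); first exact: AD.
move=> s; rewrite opprD addrACA sw_functionalD//.
apply: le_lt_trans (le_normcD _ _) _.
by rewrite [ltRHS](splitr e) ltrD.
Qed.

Lemma sw_closureZ A a T : (forall a T, A T -> A (a *: T)) ->
  sw_closure A T -> sw_closure A (a *: T).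
Proof.
move=> AZ cT r x y sx sy e e0.
have a1 : 0 < normc a + 1 by rewrite ltr_wpDl ?normc_ge0.
have [T' AT' HT] := cT r x y sx sy (e / (normc a + 1)) (divr_gt0 e0 a1).
exists (a *: T'); first exact: AZ.
move=> s; rewrite -scalerBr sw_functionalZ// normcM.
have := HT s; rewrite ltr_pdivlMr// => h; apply: le_lt_trans h.
by rewrite mulrC ler_wpM2l ?normc_ge0 ?lerDl.
Qed.

End sigma_weak_closure.

Section linear_span.
Context {R : realType} (V : lmodType R[i]) (A : set V).

Lemma lspanD (u v : V) : lspan A u -> lspan A v -> lspan A (u + v).
Proof.
move=> [n [c [a [Aa ->]]]] [n' [c' [a' [Aa' ->]]]].
exists (n + n')%N, (fun r => match fintype.split r with inl i => c i | inr i => c' i end),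
  (fun r => match fintype.split r with inl i => a i | inr i => a' i end); split.
  by move=> r; case: fintype.split.
rewrite big_split_ord/=; congr (_ + _); apply: eq_bigr => r _.
  by rewrite (unsplitK (inl r)).
by rewrite (unsplitK (inr r)).
Qed.

Lemma lspanZ d (u : V) : lspan A u -> lspan A (d *: u).
Proof.
move=> [n [c [a [Aa ->]]]]; exists n, (fun r => d * c r), a; split => //.
by rewrite scaler_sumr; apply: eq_bigr => r _; rewrite scalerA.
Qed.

Lemma sub_lspan (u : V) : A u -> lspan A u.
Proof.
by move=> Au; exists 1%N, (fun=> 1), (fun=> u); rewrite big_ord1 scale1r.
Qed.

End linear_span.

(** * Additivity of a weight and its linear extension *)

Section weight_theory.
Context {R : realType} {I : choiceType}.
Variables (M : set (bop R I I)) (phi : bop R I I -> \bar R).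
Implicit Types (S T P : bop R I I).
Local Open Scope classical_set_scope.

Lemma weight_atD S T c d : weight_at M phi S c -> weight_at M phi T d ->
  weight_at M phi (S + T) (c + d).
Proof.
move=> [n [a [P [FP -> ->]]]] [n' [a' [P' [FP' -> ->]]]].
exists (n + n')%N, (fun r => match fintype.split r with inl i => a i | inr i => a' i end),
  (fun r => match fintype.split r with inl i => P i | inr i => P' i end); split.
- by move=> r; case: fintype.split.
- rewrite big_split_ord/=; congr (_ + _); apply: eq_bigr => r _.
    by rewrite (unsplitK (inl r)).
  by rewrite (unsplitK (inr r)).
- rewrite big_split_ord/=; congr (_ + _); apply: eq_bigr => r _.
    by rewrite (unsplitK (inl r)).
  by rewrite (unsplitK (inr r)).
Qed.

Lemma weight_atZ b T c : weight_at M phi T c -> weight_at M phi (b *: T) (b * c).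
Proof.
move=> [n [a [P [FP -> ->]]]]; exists n, (fun r => b * a r), P; split => //.
  by rewrite scaler_sumr; apply: eq_bigr => r _; rewrite scalerA.
by rewrite mulr_sumr; apply: eq_bigr => r _; rewrite mulrA.
Qed.

Lemma weight_at0 : weight_at M phi 0 0.
Proof.
exists 0%N, (fun=> 0), (fun=> 0); rewrite !big_ord0; split=> [r|//|//].
by have := ltn_ord r.
Qed.

Lemma weight_at_sum n (T : 'I_n -> bop R I I) c :
  (forall r, weight_at M phi (T r) (c r)) ->
  weight_at M phi (\sum_r T r) (\sum_r c r).
Proof.
move=> h; elim/big_rec2: _ => [|r S d _ hS]; first exact: weight_at0.
exact: weight_atD.
Qed.

Lemma positive_opP T x : positive_op T -> inner (T x) x = (complex.Re (inner (T x) x))%:C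
  /\ 0 <= complex.Re (inner (T x) x).
Proof.
move=> /(_ x); case: (inner _ _) => a b; rewrite lecE/= => /andP[/eqP b0 a0].
by rewrite b0.
Qed.

Lemma positive_opD S T : positive_op S -> positive_op T -> positive_op (S + T).
Proof. by move=> pS pT x; rewrite bopDE innerDl addr_ge0. Qed.

Lemma positive_opZ (a : R) T : 0 <= a -> positive_op T -> positive_op (a%:C *: T).
Proof. by move=> a0 pT x; rewrite bopZE innerZl mulr_ge0// ler0c. Qed.

Hypothesis hphi : nsf_weight M phi.
Hypothesis MD : forall S T, M S -> M T -> M (S + T).
Hypothesis MZ : forall a T, M T -> M (a *: T).

Lemma pos_partD S T : pos_part M S -> pos_part M T -> pos_part M (S + T).
Proof. by move=> [MS pS] [MT pT]; split; [exact: MD|exact: positive_opD]. Qed.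

Lemma pos_partZ (a : R) T : 0 <= a -> pos_part M T -> pos_part M (a%:C *: T).
Proof. by move=> a0 [MT pT]; split; [exact: MZ|exact: positive_opZ]. Qed.

Lemma weight_le S T : pos_part M S -> pos_part M T -> op_le S T ->
  (phi S <= phi T)%E.
Proof.
move=> pS pT ST; have pTS : pos_part M (T - S).
  by split=> //; apply: MD; [case: pT|rewrite -scaleN1r; apply: MZ; case: pS].
rewrite -[T](subrK S) (weightD hphi pTS pS) leeDr//.
exact: weight_ge0 hphi _ pTS.
Qed.

(** The extra summand [P0] may have infinite weight; in [weight_at_pos] it is once the operator
    under study and once 0. *)
Lemma weight_sum P0 n (a : 'I_n -> R) (P : 'I_n -> bop R I I) :
  pos_part M P0 -> (forall r, 0 <= a r) -> (forall r, finite_pos M phi (P r)) ->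
  pos_part M (P0 + \sum_r (a r)%:C *: P r) /\
  phi (P0 + \sum_r (a r)%:C *: P r) =
    (phi P0 + (\sum_r a r * fine (phi (P r)))%:E)%E.
Proof.
move=> hP0 a0 FP; apply: (big_rec2 (fun T s =>
    pos_part M (P0 + T) /\ phi (P0 + T) = (phi P0 + s%:E)%E)) => [|r T s _ [IHp IHe]].
  by rewrite !addr0.
have [pr fr] := FP r.
have pZ := pos_partZ (a0 r) pr.
rewrite (addrC _ T) addrA; split; first exact: pos_partD.
rewrite (weightD hphi IHp pZ) IHe (weightZ hphi (a0 r) pr).
rewrite -{1}[phi (P r)]fineK ?ge0_fin_numE ?(weight_ge0 hphi pr)//.
by rewrite -addeA -EFinM -EFinD (addrC s).
Qed.

(** Links the linear extension to the weight itself, and shows that the value does not depend on the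
    decomposition. Moving the negative coefficients of P = sum a_r Q_r to the other side gives an
    identity between positive combinations, to which additivity applies. *)
Lemma weight_at_pos P c : pos_part M P -> weight_at M phi P c ->
  phi P = (complex.Re c)%:E.
Proof.
move=> pP [n [a [Q [FQ EP Ec]]]].
pose re r := complex.Re (a r).
pose ap r := Num.max (re r) 0; pose an r := Num.max (- re r) 0.
have apan r : re r = ap r - an r.
  by rewrite /ap /an /Order.max; do ! case: ifPn; rewrite -?leNgt; lra.
have ap0 r : 0 <= ap r by rewrite le_max lexx orbT.
have an0 r : 0 <= an r by rewrite le_max lexx orbT.
have [M0 p0] : pos_part M (0 : bop R I I).
  by rewrite -(scale0r P); exact: pos_partZ.
have phi0 : phi 0 = 0%E.
  by rewrite -(scale0r P) (weightZ hphi (lexx 0) pP) mul0e.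
have E : P + \sum_r (an r)%:C *: Q r = 0 + \sum_r (ap r)%:C *: Q r.
  apply/eqP; rewrite add0r -subr_eq0; apply/eqP/quadratic_form_eq0 => x.
  rewrite -addrA -sumrB bopDE innerDl bop_sumE inner_suml.
  have [hP _] := positive_opP x (proj2 pP).
  have hQ r : inner (Q r x) x = (complex.Re (inner (Q r x) x))%:C.
    by have [[_ /(positive_opP x)[]]] := FQ r.
  (* The form of [P] is real, so the imaginary parts of the coefficients drop out. *)
  have -> : inner (P x) x = \sum_r (re r)%:C * inner (Q r x) x.
    rewrite hP EP bop_sumE inner_suml.
    rewrite !raddf_sum; apply: eq_bigr => r _.
    rewrite bopZE innerZl hQ /re; case: (a r) => u v /=.
    by apply/eqP; rewrite eq_complex/=; apply/andP; split; apply/eqP; ring.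
  rewrite -big_split big1// => r _ /=.
  by rewrite innerBl !innerZl apan rmorphB/=; ring.
have [_ E1] := weight_sum pP an0 FQ.
have [_ E2] := weight_sum (conj M0 p0) ap0 FQ.
(* The right-hand combination has finite weight, which excludes an infinite [phi P]. *)
have := E1; rewrite E E2 phi0 add0e; case: (phi P) => [p| |]//= [/eqP].
rewrite -subr_eq => /eqP <-; congr _%:E; rewrite Ec -sumrB (raddf_sum (@complex.Re R)).
apply: eq_bigr => r _; rewrite -mulrBl -apan /re.
by case: (a r) => u v /=; ring.
Qed.

End weight_theory.

(** * Normality and polarization *)

Section adjoints.
Context {R : realType} {I J : choiceType}.

Lemma is_adjointD (S T : bop R I J) (S' T' : bop R J I) :
  is_adjoint S S' -> is_adjoint T T' -> is_adjoint (S + T) (S' + T').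
Proof. by move=> hS hT x y; rewrite !bopDE innerDl innerDr hS hT. Qed.

Lemma is_adjointZ a (T : bop R I J) (T' : bop R J I) :
  is_adjoint T T' -> is_adjoint (a *: T) (conjc a *: T').
Proof. by move=> hT x y; rewrite !bopZE innerZl innerZr conjcK hT. Qed.

Lemma bop_lin (T : bop R I J) a x y : T (x + a *: y) = T x + a *: T y.
Proof. by rewrite linearD linearZ. Qed.

End adjoints.

(** * Truncation by diagonal projections, and normality *)

Section corner.
Context {R : realType} {J : choiceType}.
Local Open Scope classical_set_scope.

Lemma cproj_ok (A : pred J) : wcomp_ok (fun j => (A j)%:R : R) id.
Proof.
by split=> [|//]; exists 1 => j; case: (A j); rewrite ?normr1 ?normr0.
Qed.

Definition cproj (A : pred J) : bop R J J := wcomp (cproj_ok A).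

Lemma cprojE A x j : cproj A x j = if A j then x j else 0.
Proof. by rewrite /=; case: (A j); rewrite ?mul1r ?mul0r. Qed.

Lemma inner_cproj A x : inner (cproj A x) x = (normsq2 (cproj A x))%:C.
Proof.
rewrite -innerxx /inner; congr csum; apply/funext => j.
by rewrite cprojE; case: (A j); rewrite ?mul0r.
Qed.

Lemma le_normsq2_cproj (A B : pred J) x : (forall j, A j -> B j) ->
  normsq2 (cproj A x) <= normsq2 (cproj B x).
Proof.
move=> AB; rewrite -lee_fin -!enormsqE; apply: le_esum => j _.
rewrite lee_fin !cprojE; case: ifPn => [Aj|_]; first by rewrite AB.
by rewrite normc0 expr0n sqr_ge0.
Qed.

Lemma cprojT x : cproj predT x = x.
Proof. by apply/val_inj/funext => j; exact: cprojE. Qed.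

(** The squared norm is a supremum over finite index sets, and each such set lies below some
    level. *)
Lemma normsq2_le_cproj (lev : J -> nat) x (c : R) :
  (forall N, normsq2 (cproj (fun j => lev j < N)%N x) <= c) -> normsq2 x <= c.
Proof.
move=> h; rewrite -lee_fin -enormsqE; apply: ge_ereal_sup => _ [X [finX _] <-].
have [F XF] := finite_fsetP.1 finX.
pose N := (\max_(j <- finmap.enum_fset F) lev j).+1.
apply: (@le_trans _ _ (enormsq (cproj (fun j => lev j < N)%N x))); last first.
  by rewrite enormsqE lee_fin.
apply: esum_ge; exists X; first by split.
rewrite le_eqVlt; apply/orP; left; apply/eqP/eq_fsbigr => j; rewrite inE XF => jF.
by rewrite cprojE ltnS (leq_bigmax_seq j).
Qed.

Context {I : choiceType}.
Variables (Z : bop R J I) (Zs : bop R I J) (hZ : is_adjoint Z Zs).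

Definition corner A : bop R I I := Z \bo cproj A \bo Zs.

Lemma inner_corner A x : inner (corner A x) x = (normsq2 (cproj A (Zs x)))%:C.
Proof. by rewrite -inner_cproj -hZ. Qed.

Lemma cornerT : corner predT = Z \bo Zs.
Proof. by apply: bop_ext => x i; rewrite /= -[in RHS](cprojT (Zs x)). Qed.

Lemma positive_corner A : positive_op (corner A).
Proof. by move=> x; rewrite inner_corner ler0c normsq2_ge0. Qed.

Lemma le_corner (A B : pred J) : (forall j, A j -> B j) -> op_le (corner A) (corner B).
Proof.
move=> AB x; rewrite bopDE bopNE innerBl !inner_corner -rmorphB ler0c subr_ge0.
exact: le_normsq2_cproj.
Qed.

Variables (M : set (bop R I I)) (phi : bop R I I -> \bar R).
Hypothesis hphi : nsf_weight M phi.
Hypothesis MD : forall S T, M S -> M T -> M (S + T).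
Hypothesis MZ : forall a T, M T -> M (a *: T).

Variable lev : J -> nat.
Let below N : pred J := fun j => (lev j < N)%N.

(** The truncations increase to Z Z^* as quadratic forms, so normality makes the weight of Z Z^* the
    supremum of an increasing real sequence, which is its limit. *)
Lemma weight_corner (u : nat -> R) (l : R) :
  M (Z \bo Zs) -> (forall N, M (corner (below N))) ->
  (forall N, phi (corner (below N)) = (u N)%:E) ->
  u n @[n --> \oo] --> l -> phi (Z \bo Zs) = l%:E.
Proof.
rewrite -cornerT => MT MN phiN ul.
have pT : pos_part M (corner predT) by split; [|exact: positive_corner].
have pN N : pos_part M (corner (below N)) by split; [|exact: positive_corner].
have le N N' : (N <= N')%N -> op_le (corner (below N)) (corner (below N')).
  by move=> NN'; apply: le_corner => j /leq_trans; exact.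
pose D := [set corner (below N) | N in [set: nat]].
have -> : phi (corner predT) = ereal_sup [set phi S | S in D].
  apply: (weight_normal hphi) pT _ => //.
  - by move=> _ [N _ <-].
  - split; first by exists (corner (below 0)), 0%N.
    move=> _ _ [N _ <-] [N' _ <-]; exists (corner (below (maxn N N'))).
      by exists (maxn N N').
    by split; apply: le; rewrite ?leq_maxl ?leq_maxr.
  (* An upper bound [U] dominates |P_N Z^* x|^2 for every N, hence |Z^* x|^2. *)
  - split=> [_ [N _ <-]|U [MU pU] UN x]; first exact: le_corner.
    have [eU _] := positive_opP x pU.
    rewrite bopDE bopNE innerBl inner_corner cprojT eU.
    rewrite -rmorphB ler0c subr_ge0; apply: (@normsq2_le_cproj lev) => N.
    have := UN (corner (below N)) (ex_intro2 _ _ N Logic.I erefl) x.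
    by rewrite bopDE bopNE innerBl inner_corner eU -rmorphB ler0c subr_ge0.
rewrite image_comp (_ : phi \o _ = EFin \o u); last exact/funext.
have nd : {homo (EFin \o u) : N N' / (N <= N')%N >-> (N <= N')%E}.
  move=> N N' NN'; rewrite /= -!phiN; apply: (weight_le hphi MD MZ) => //.
  exact: le.
have /(cvg_lim (@ereal_hausdorff R)) <- := ereal_nondecreasing_cvgn nd.
by apply: cvg_lim => //; apply: cvg_EFin => //; exact: nearW.
Qed.

End corner.

(** * Polarization: from weights of Z Z^* to those of X Y^* *)

Section polarization.
Context {R : realType} {I J : choiceType}.
Local Open Scope classical_set_scope.
Variables (M : set (bop R I I)) (phi : bop R I I -> \bar R).
Hypothesis hphi : nsf_weight M phi.
Hypothesis MD : forall S T, M S -> M T -> M (S + T).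
Hypothesis MZ : forall a T, M T -> M (a *: T).
Variables (X Y : bop R J I) (Xs Ys : bop R I J).
Hypothesis hX : is_adjoint X Xs.
Hypothesis hY : is_adjoint Y Ys.
Variable lev : J -> nat.
Let below N : pred J := fun j => (lev j < N)%N.
Let piece (V : bop R J I) (Ws : bop R I J) A : bop R I I := V \bo cproj A \bo Ws.

(** Quantifying over all predicates on levels covers the truncations r < N and, with [predT], the
    full products. *)
Hypothesis MXX : forall A : pred nat, M (piece X Xs (A \o lev)).
Hypothesis MXY : forall A : pred nat, M (piece X Ys (A \o lev)).
Hypothesis MYX : forall A : pred nat, M (piece Y Xs (A \o lev)).
Hypothesis MYY : forall A : pred nat, M (piece Y Ys (A \o lev)).

(** With Z_w = X + w Y, the product X Y^* is the sum of (w/4) Z_w Z_w^* over w in {1, -1, i, -i}.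
    The two mixed pieces share the real weights [c], so Z_w Z_w^* has weight la + lb + 2 Re(w)
    lc. *)
Lemma weight_polarization (a b c : nat -> R) (la lb lc : R) :
  (forall N, weight_at M phi (piece X Xs (below N)) (a N)%:C) ->
  (forall N, weight_at M phi (piece Y Ys (below N)) (b N)%:C) ->
  (forall N, weight_at M phi (piece X Ys (below N)) (c N)%:C) ->
  (forall N, weight_at M phi (piece Y Xs (below N)) (c N)%:C) ->
  a n @[n --> \oo] --> la -> b n @[n --> \oo] --> lb -> c n @[n --> \oo] --> lc ->
  weight_at M phi (X \bo Ys) lc%:C.
Proof.
move=> wXX wYY wXY wYX ca cb cc.
pose Z w := X + w *: Y; pose Zs w := Xs + conjc w *: Ys.
have hZ w : is_adjoint (Z w) (Zs w) by exact/is_adjointD/is_adjointZ.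
have ZE w A : w * conjc w = 1 -> corner (Z w) (Zs w) A =
    piece X Xs A + conjc w *: piece X Ys A + (w *: piece Y Xs A + piece Y Ys A).
  move=> w1; apply/val_inj/funext => x.
  change (X (cproj A (Xs x + conjc w *: Ys x)) + w *: Y (cproj A (Xs x + conjc w *: Ys x))
    = X (cproj A (Xs x)) + conjc w *: X (cproj A (Ys x)) +
      (w *: Y (cproj A (Xs x)) + Y (cproj A (Ys x)))).
  by rewrite !bop_lin scalerDr scalerA w1 scale1r.
have wZ w N : w * conjc w = 1 -> weight_at M phi (corner (Z w) (Zs w) (below N))
    ((a N)%:C + conjc w * (c N)%:C + (w * (c N)%:C + (b N)%:C)).
  by move=> w1; rewrite ZE//; do ! apply: weight_atD => //; exact: weight_atZ.
have MZZ w (A : pred nat) : w * conjc w = 1 -> M (corner (Z w) (Zs w) (A \o lev)).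
  by move=> w1; rewrite ZE//; do ! apply: MD => //; exact: MZ.
have phiZ w : w * conjc w = 1 ->
    weight_at M phi (Z w \bo Zs w) (la + lb + 2 * complex.Re w * lc)%:C.
  move=> w1; have MT : M (Z w \bo Zs w) by rewrite -cornerT; exact: (MZZ w predT).
  have E : phi (Z w \bo Zs w) = (la + lb + 2 * complex.Re w * lc)%:E.
    apply: (weight_corner (hZ w) hphi MD MZ (lev := lev)
      (u := fun N => a N + b N + 2 * complex.Re w * c N)) => //.
    - by move=> N; exact: (MZZ w (fun r => r < N)%N).
    - move=> N; rewrite (weight_at_pos hphi MD MZ _ (wZ w N w1)); last first.
        by split; [exact: (MZZ w (fun r => r < N)%N)|exact: positive_corner].
      by congr _%:E; case: (w) => u v /=; ring.
    - by apply: cvgD; [exact: cvgD|exact: cvgMl_tmp].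
  (* Having finite weight, Z_w Z_w^* is its own decomposition into finite positive operators. *)
  exists 1%N, (fun=> 1), (fun=> Z w \bo Zs w); split.
  - move=> _; split; last by rewrite E ltry.
    by split=> //; rewrite -cornerT; exact: positive_corner.
  - by rewrite big_ord1 scale1r.
  - by rewrite big_ord1 E mul1r.
pose W (w : R[i]) := (w / 4) *: (Z w \bo Zs w).
have XYE : X \bo Ys = W 1 + W (-1) + (W 'i%C + W (- 'i%C)).
  have WE w x : W w x = (w / 4) *: (X (Xs x) + conjc w *: X (Ys x) +
      w *: (Y (Xs x) + conjc w *: Y (Ys x))).
    transitivity ((w / 4) *: (X (Xs x + conjc w *: Ys x) +
      w *: Y (Xs x + conjc w *: Ys x))) => //.
    by rewrite !bop_lin.
  apply: bop_ext => x i.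
  have WD (S T U V : bop R I I) : (S + T + (U + V)) x i =
    S x i + T x i + (U x i + V x i) by [].
  rewrite WD.
  rewrite (WE 1) (WE (-1)) (WE 'i%C) (WE (- 'i%C)) !(ell2DE, ell2ZE).
  have -> : conjc (-1 : R[i]) = -1 by rewrite rmorphN rmorph1.
  have -> : conjc (1 : R[i]) = 1 by rewrite rmorph1.
  have -> : conjc (- 'i%C : R[i]) = 'i%C.
    by apply/eqP; rewrite eq_complex/= oppr0 opprK !eqxx.
  have -> : conjc ('i%C : R[i]) = - 'i%C by apply/eqP; rewrite eq_complex/= oppr0 !eqxx.
  have i2 : 'i%C * 'i%C = -1 :> R[i] by rewrite -expr2 sqr_i.
  rewrite [LHS]/=; move: (ell2_val (X (Xs x)) i) (ell2_val (X (Ys x)) i)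
    (ell2_val (Y (Xs x)) i) (ell2_val (Y (Ys x)) i) => xx xy yx yy.
  move: 'i%C i2 => j i2.
  by field: i2.
have i1 (s : R[i]) : s = 'i%C \/ s = - 'i%C -> s * conjc s = 1.
  by case=> ->; apply/eqP; rewrite eq_complex/=; apply/andP; split; apply/eqP; ring.
have o1 (s : R[i]) : s = 1 \/ s = - 1 -> s * conjc s = 1.
  by case=> ->; apply/eqP; rewrite eq_complex/=; apply/andP; split; apply/eqP; ring.
have wW w : w * conjc w = 1 ->
    weight_at M phi (W w) (w / 4 * (la + lb + 2 * complex.Re w * lc)%:C).
  by move=> w1; apply: weight_atZ; exact: phiZ.
(* The terms for w = i and w = -i cancel; those for 1 and -1 give lc/2 each. *)
rewrite XYE (_ : lc%:C = 1 / 4 * (la + lb + 2 * complex.Re (1 : R[i]) * lc)%:C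
   + -1 / 4 * (la + lb + 2 * complex.Re (- 1 : R[i]) * lc)%:C
   + ('i%C / 4 * (la + lb + 2 * complex.Re ('i%C : R[i]) * lc)%:C
   + - 'i%C / 4 * (la + lb + 2 * complex.Re (- 'i%C : R[i]) * lc)%:C)).
  do ! apply: weight_atD; apply: wW;
    [by apply: o1; left|by apply: o1; right|by apply: i1; left|by apply: i1; right].
rewrite /= oppr0; set j := 'i%C.
have -> : (la + lb + 2 * 1 * lc)%:C = (la + lb)%:C + 2 * lc%:C.
  by rewrite mulr1 rmorphD rmorphM/= rmorph_nat.
have -> : (la + lb + 2 * -1 * lc)%:C = (la + lb)%:C - 2 * lc%:C.
  by rewrite mulrN1 mulNr rmorphB rmorphM/= rmorph_nat.
by field.
Qed.

End polarization.

(** * Weighted shifts *)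

Section weighted_shifts.
Context {R : realType}.
Local Open Scope classical_set_scope.
Local Notation SU := (bop R idxSU idxN).
Local Notation SUs := (bop R idxN idxSU).
Local Notation EN := (bop R idxN idxN).

Definition nat_ext (c : nat -> R) (p : int) : R := if p is Posz r then c r else 0.

Definition bounded_seq (c : nat -> R) := exists C : R, forall r, `|c r| <= C.

Lemma bounded_nat_ext c : bounded_seq c -> exists C : R, forall p, `|nat_ext c p| <= C.
Proof.
move=> [C hC]; exists C => -[r|r] //=; rewrite normr0.
exact: le_trans (hC 0%N).
Qed.

Lemma bounded_seqM c d : bounded_seq c -> bounded_seq d ->
  bounded_seq (fun r => c r * d r).
Proof.
move=> [C hC] [D hD]; exists (C * D) => r.
by rewrite normrM ler_pM.
Qed.

(* [sum_r c_r e_(r-a),r (x) 1 (x) S^d] *)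
Definition is_shift (X : SU) (c : nat -> R) (a d : int) := forall u p m k,
  X u (p, m, k) = (nat_ext c (p + a))%:C * u (absz (p + a), m, k - d).

(* [sum_r c_r e_(r-a),(r-b) (x) 1 (x) S^d] *)
Definition is_band (T : EN) (c : nat -> R) (a b d : int) := forall u p m k,
  T u (p, m, k) = (nat_ext c (p + a))%:C * u (p + a - b, m, k - d).

Section adjoint_shift.
Variables (c : nat -> R) (hc : bounded_seq c) (a d : int).

Lemma shift_adj_ok : wcomp_ok (fun t : idxSU => c t.1.1)
  (fun t => ((t.1.1%:Z - a, t.1.2, t.2 + d) : idxN)).
Proof.
split; first by have [C hC] := hc; exists C.
by move=> [[r m] k] [[r' m'] k'] _ _ /= [] /addIr[->] -> /addIr ->.
Qed.

Definition shift_adj : SUs := wcomp shift_adj_ok.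

(** The substitution p = r - a matches the two sums; indices with p + a < 0 contribute nothing, and
    the coefficients are real. *)
Lemma is_adjoint_shift X : is_shift X c a d -> is_adjoint X shift_adj.
Proof.
move=> hX x y; apply/esym.
apply: (csum_supp (D := setT)
  (f := fun t : idxSU => ((t.1.1%:Z - a, t.1.2, t.2 + d) : idxN))).
- by right.
- move=> [[p m] k]; rewrite hX; case E : (p + a) => [r|r].
    by right; exists (r, m, k - d) => //=; rewrite -E addrK subrK.
  by left; rewrite /= !mul0r.
- move=> [[r m] k] _; by rewrite hX /= subrK addrK /= rmorphM/= oppr0 mulrCA mulrA.
- by move=> [[r m] k] [[r' m'] k'] _ _ /= [] /addIr[->] -> /addIr ->.
Qed.

End adjoint_shift.

(** Both shifts and the projection pass through the same index r, so their coefficients multiply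
    pointwise. *)
Lemma is_band_piece X c a d c' (hc' : bounded_seq c') a' d' (A : pred nat) :
  is_shift X c a d ->
  is_band (X \bo cproj (A \o (fun t : idxSU => t.1.1)) \bo shift_adj hc' a' d')
    (fun r => (A r)%:R * (c r * c' r)) a a' (d - d').
Proof.
move=> hX u p m k.
rewrite [LHS](hX (cproj _ (shift_adj hc' a' d' u))) cprojE /=.
case: (p + a) => [r|r] /=; last by rewrite !mul0r.
case: (A r); rewrite ?mul0r ?mulr0// mul1r opprB addrA rmorphM/= mulrA.
by rewrite (addrAC k).
Qed.

Lemma opexp_comm (I : choiceType) (S T : bop R I I) n :
  S \bo T = T \bo S -> opexp S n \bo T = T \bo opexp S n.
Proof.
move=> ST; have STE x : S (T x) = T (S x).
  exact: (congr1 (fun V : bop R I I => V x) ST).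
elim: n => [|n IHn]; first by apply: bop_ext.
have IHE x : opexp S n (T x) = T (opexp S n x).
  exact: (congr1 (fun V : bop R I I => V x) IHn).
apply/val_inj/funext => x.
by transitivity (S (opexp S n (T x))) => //; rewrite IHE STE.
Qed.

Lemma LZ_uexpz (k : int) : LZ (uexpz (@Defs.shift R) k).
Proof.
move=> S hS.
have h : S \bo Defs.shift = Defs.shift \bo S by apply/esym/hS; left.
have h' : S \bo adj Defs.shift = adj Defs.shift \bo S.
  by apply/esym/hS; right; exists Defs.shift.
by apply/esym; case: k => n; exact: opexp_comm.
Qed.

(** Read off from the entries of e_00 (x) 1 (x) S^k. *)
Lemma uexpz_shift (k l l' : int) :
  uexpz (@Defs.shift R) k (Defs.basis l) l' = (l' - k == l)%:R.
Proof.
have := @munit_shift_tensor R 0 0 k 0 0%N l 0 0%N l'.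
by rewrite /= !mul1r => <-.
Qed.

(** A band is one elementary tensor x (x) 1 (x) S^d with x a bounded weighted shift, so it lies in
    the span before closure. *)
Lemma Linf_band T c a b d : bounded_seq c -> is_band T c a b d -> Linf_Eq2 T.
Proof.
move=> hc hT.
have ok : wcomp_ok (fun p : int => nat_ext c (p + a)) (fun p => p + a - b).
  split; last by move=> p p' _ _ /addIr/addIr.
  by have [C hC] := bounded_nat_ext hc; exists C.
apply/sub_sw_closure/sub_lspan; exists (wcomp ok), (uexpz Defs.shift d).
split; first exact: LZ_uexpz.
move=> n m k n' m' k'; rewrite hT uexpz_shift /= !xpair_eqE.
by rewrite -!mulrA -!natrM !mulnb andbA.
Qed.

Lemma Linf_Eq2D (S T : EN) : Linf_Eq2 S -> Linf_Eq2 T -> Linf_Eq2 (S + T).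
Proof. by apply: sw_closureD; exact: lspanD. Qed.

Lemma Linf_Eq2Z a (T : EN) : Linf_Eq2 T -> Linf_Eq2 (a *: T).
Proof. by apply: sw_closureZ; exact: lspanZ. Qed.

Lemma band_sum T c a b d N :
  is_band T (fun r => (r < N)%N%:R * c r) a b d ->
  T = \sum_(r < N) (c r)%:C *: munit_shift (r%:Z - a) (r%:Z - b) d.
Proof.
move=> hT; apply/val_inj/funext => u; apply/val_inj/funext => -[[p m] k].
rewrite [LHS]hT.
have -> : val (val (\sum_(r < N) (c r)%:C *: munit_shift (r%:Z - a) (r%:Z - b) d) u)
    (p, m, k) = \sum_(r < N) (c r)%:C * ((p == r%:Z - a)%:R%:C * u (r%:Z - b, m, k - d)).
  by rewrite /= bop_sumE; elim/big_rec2: _ => // r x y _ <-.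
(* Row p receives only the term r = p + a, present when 0 <= p + a < N. *)
case E : (p + a) => [s|s] /=; last first.
  rewrite mul0r big1// => r _; rewrite eq_sym subr_eq eq_sym E.
  by rewrite mul0r mulr0.
case: (ltnP s N) => [sN|Ns]; last first.
  rewrite mul0r mul0r big1// => r _; rewrite -subr_eq opprK E.
  rewrite (_ : (s%:Z == r%:Z) = false) ?mul0r ?mulr0//.
  by apply/negbTE/eqP => -[] sr; have := ltn_ord r; rewrite -sr ltnNge Ns.
rewrite (bigD1 (Ordinal sN))//= -subr_eq opprK E eqxx mul1r mul1r big1 ?addr0//.
move=> r rs; rewrite -subr_eq opprK E (_ : (s%:Z == r%:Z) = false) ?mul0r ?mulr0//.
by apply/negbTE; apply: contraNN rs => /eqP[sr]; apply/eqP/val_inj.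
Qed.

(** The r-th matrix unit has row r - a, whence the power of q; it is diagonal exactly when a = b. *)
Lemma weight_band (q : R) phi T c a b d N : is_phi0 q phi ->
  is_band T (fun r => (r < N)%N%:R * c r) a b d ->
  weight_at (@Linf_Eq2 R) phi T
    (\sum_(r < N) c r * ((a == b)%:R * (d == 0)%:R * q ^ (2 * (r%:Z - a))))%:C.
Proof.
move=> [_ hphi] /band_sum ->; rewrite rmorph_sum; apply: weight_at_sum => r.
rewrite rmorphM; apply: weight_atZ.
have := hphi (r%:Z - a) (r%:Z - b) d.
by rewrite (inj_eq (addrI _)) eqr_opp !rmorphM !rmorph_nat.
Qed.

End weighted_shifts.

(** * The operators G *)

Section matrix_coefficients.
Context {R : realType}.
Local Open Scope classical_set_scope.
Variables (q : R) (hq : 0 < q < 1).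
Local Notation Q := (q ^+ 2).

(** Here n is the smaller index of G_ts and D = |t - s|. The factors come from the scalar in front,
    from L_0+, from b^D, and from the Wall polynomial at the eigenvalue q^(2r) of b^* b. *)
Definition wall_coef (n D r : nat) : R :=
  Num.sqrt (qpoch Q Q (n + D) / qpoch Q Q n) / (q ^+ (n * D) * qpoch Q Q D)
  * Num.sqrt (qpoch_inf (q ^+ (2 * r + 2)) Q) * q ^+ (r * D)
  * (wall n (q ^+ (2 * D)) Q).[Q ^+ r].

Definition G_coef (i j r : nat) : R :=
  if (i <= j)%N then wall_coef i (j - i) r
  else (- q) ^+ (i - j) * wall_coef j (i - j) r.

Let q0 : 0 < q. Proof. by case/andP: hq. Qed.
Let q1 : q < 1. Proof. by case/andP: hq. Qed.
Let hQ : 0 < Q < 1.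
Proof. by rewrite exprn_gt0// exprn_ilt1// ltW. Qed.
Let q01 n : 0 <= q ^+ n <= 1.
Proof. by rewrite exprn_ge0 ?exprn_ile1// ltW. Qed.
Let Q01 n : 0 <= Q ^+ n <= 1.
Proof. by rewrite -exprM. Qed.

(** The points Q^r lie in the unit disk, where the polynomial is bounded; the other factors
    depending on r are at most 1. *)
Lemma bounded_wall_coef n D : bounded_seq (wall_coef n D).
Proof.
have [C hC] := poly_disk_bound (wall n (q ^+ (2 * D)) Q) 1.
pose K := Num.sqrt (qpoch Q Q (n + D) / qpoch Q Q n) / (q ^+ (n * D) * qpoch Q Q D).
exists (`|K| * C) => r.
rewrite (_ : wall_coef n D r = K * (Num.sqrt (qpoch_inf (q ^+ (2 * r + 2)) Q) *
  q ^+ (r * D) * (wall n (q ^+ (2 * D)) Q).[Q ^+ r])); last first.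
  by rewrite /wall_coef -/K !mulrA.
rewrite normrM ler_wpM2l// normrM.
rewrite -[leRHS]mul1r ler_pM//; last first.
  by apply: hC; have /andP[h0 h1] := Q01 r; rewrite ger0_norm.
have /andP[h0 h1] := q01 (r * D).
rewrite normrM (ger0_norm (sqrtr_ge0 _)) (ger0_norm h0) mulr_ile1 ?sqrtr_ge0//.
rewrite -[leRHS]sqrtr1 ler_wsqrtr//.
by have /andP[] := qpoch_inf_itv (q01 (2 * r + 2)) (Q01 1).
Qed.

Lemma bounded_G_coef i j : bounded_seq (G_coef i j).
Proof.
rewrite /G_coef /bounded_seq; case: (leqP i j) => _; first exact: bounded_wall_coef.
have [C hC] := bounded_wall_coef j (i - j); exists (`|(- q) ^+ (i - j)| * C) => r.
by rewrite normrM ler_wpM2l.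
Qed.

(** The two square roots multiply to (Q^(r+1);Q)_oo and the powers of q to Q^((D+1)r), the weight of
    [wall_orthogonal] with p = Q. The constants K reduce its norms to Q^n. *)
Lemma cvg_wall_coefM n n' D :
  \sum_(r < N) wall_coef n D r * wall_coef n' D r * Q ^+ r @[N --> \oo]
    --> (n == n')%:R * Q ^+ n.
Proof.
pose K m := Num.sqrt (qpoch Q Q (m + D) / qpoch Q Q m) / (q ^+ (m * D) * qpoch Q Q D).
pose W m := wall m (Q ^+ D) Q.
have Pp m : 0 < qpoch Q Q m by exact: (qpoch_gt0 hQ 0).
rewrite (_ : (fun N => _) = (fun N => K n * K n' *
    \sum_(r < N) qpoch_inf (Q ^+ r.+1) Q * Q ^+ (D.+1 * r) * (W n * W n').[Q ^+ r])).
  have -> : (n == n')%:R * Q ^+ n =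
      K n * K n' * wall_functional Q D (W n * W n').
    rewrite wall_orthogonal//; case: eqVneq => [<-|_]; last by rewrite !mul0r mulr0.
    rewrite !mul1r /K -expr2 expr_div_n sqr_sqrtr; last first.
      by rewrite divr_ge0// ltW.
    rewrite exprMn (addnC n D) exprAC mulSn exprD (mulnC D n).
    by field; rewrite !gt_eqF ?Pp ?exprn_gt0.
  by apply: cvgMl_tmp; exact: cvg_wall_functional.
apply/funext => N; rewrite mulr_sumr; apply: eq_bigr => r _.
rewrite /wall_coef -/(K n) -/(K n') hornerM /W.
have -> : q ^+ (2 * D) = Q ^+ D by rewrite exprM.
have -> : q ^+ (2 * r + 2) = Q ^+ r.+1 by rewrite -exprM; congr (_ ^+ _); lia.
have -> : Q ^+ (D.+1 * r) = q ^+ (r * D) * q ^+ (r * D) * Q ^+ r.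
  by rewrite -!exprM -!exprD; congr (_ ^+ _); lia.
have /andP[h0 _] := qpoch_inf_itv (Q01 r.+1) (Q01 1).
rewrite -{3}(sqr_sqrtr h0).
set s := Num.sqrt _; ring.
Qed.

(** Equal differences put both coefficients in the same branch with the same D. Below the diagonal
    the two signed powers multiply to Q^(i-j), which turns Q^j into Q^i. *)
Lemma cvg_G_coefM i j k l : j%:Z - i%:Z = l%:Z - k%:Z ->
  \sum_(r < N) G_coef i j r * G_coef k l r * Q ^+ r @[N --> \oo]
    --> (i == k)%:R * Q ^+ i.
Proof.
move=> ijkl; rewrite /G_coef; case: leqP => ij.
  have -> : (k <= l)%N by lia.
  have -> : (l - k = j - i)%N by lia.
  exact: cvg_wall_coefM.
have -> : (k <= l)%N = false by lia.
have -> : (k - l = i - j)%N by lia.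
rewrite (_ : (fun N => _) = (fun N => Q ^+ (i - j) *
    \sum_(r < N) wall_coef j (i - j) r * wall_coef l (i - j) r * Q ^+ r)).
  have -> : (i == k)%:R * Q ^+ i = Q ^+ (i - j) * ((j == l)%:R * Q ^+ j).
    rewrite mulrCA -exprD subnK ?(ltnW ij)//; congr (_%:R * _).
    by apply/eqP/eqP; lia.
  by apply: cvgMl_tmp; exact: cvg_wall_coefM.
apply/funext => N; rewrite mulr_sumr; apply: eq_bigr => r _.
have -> : Q ^+ (i - j) = (- q) ^+ (i - j) * (- q) ^+ (i - j).
  by rewrite -exprMn mulrNN -expr2.
by ring.
Qed.

(** * Coordinates of [v], [b], [L0] and of the operators [Gn] *)

Lemma opexpS (I : choiceType) (T : bop R I I) n x : opexp T n.+1 x = T (opexp T n x).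
Proof. by []. Qed.

Lemma opexp_vE n u p m k : opexp (@v R) n u (p, m, k) = u (p + n%:Z, m, k).
Proof.
elim: n p => [|n IHn] p; first by rewrite addr0.
rewrite opexpS [LHS]/= mul1r IHn; congr (ell2_val u (_, _, _)); lia.
Qed.

Lemma adj_v_ok : wcomp_ok (fun _ : idxN => 1 : R)
  (fun t : idxN => ((t.1.1 - 1, t.1.2, t.2) : idxN)).
Proof.
split; first by exists 1 => j; rewrite normr1.
by move=> [[n m] k] [[n' m'] k'] _ _ /= [] /addIr -> -> ->.
Qed.

Lemma adj_vE : adj (@v R) = wcomp adj_v_ok.
Proof. by apply: adj_wcomp => -[[n m] k] _ /=; rewrite ?addrK ?subrK. Qed.

Lemma uexpz_vE n u p m k : uexpz (@v R) n u (p, m, k) = u (p + n, m, k).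
Proof.
case: n => n; first exact: opexp_vE.
rewrite /uexpz adj_vE NegzE; elim: n.+1 p => {n} [|n IHn] p; first by rewrite addr0.
rewrite opexpS [LHS]/= mul1r IHn; congr (ell2_val u (_, _, _)); lia.
Qed.

Lemma opexp_bE n u r m k :
  opexp (b hq) n u (r, m, k) = (q ^+ (r * n))%:C * u (r, m, k - n%:Z).
Proof.
elim: n k => [|n IHn] k; first by rewrite muln0 expr0 mul1r subr0.
rewrite opexpS [LHS]/= IHn mulrA -rmorphM -exprD mulnS.
congr (_ * ell2_val u (_, _, _)); lia.
Qed.

Lemma adj_b_ok : wcomp_ok (fun t : idxSU => q ^+ t.1.1)
  (fun t : idxSU => ((t.1.1, t.1.2, t.2 + 1) : idxSU)).
Proof.
split.
  by exists 1 => t; have /andP[h0 h1] := q01 t.1.1; rewrite ger0_norm.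
by move=> [[n m] k] [[n' m'] k'] _ _ /= [] -> -> /addIr ->.
Qed.

Lemma adj_bE : adj (b hq) = wcomp adj_b_ok.
Proof. by apply: adj_wcomp => -[[n m] k] _ /=; rewrite ?addrK ?subrK. Qed.

Lemma opexp_adj_bE (c : R) n u r m k :
  opexp (c%:C *: adj (b hq)) n u (r, m, k) =
  (c ^+ n * q ^+ (r * n))%:C * u (r, m, k + n%:Z).
Proof.
rewrite adj_bE; elim: n k => [|n IHn] k; first by rewrite muln0 expr0 !mul1r addr0.
rewrite opexpS bopZE ell2ZE [wcomp _ _ _]/= IHn !mulrA -!rmorphM mulnS exprD exprS.
congr (_%:C * ell2_val u (_, _, _)); [by ring|lia].
Qed.

Lemma oppoly_bE (P : {poly R}) u r m k :
  oppoly P (adj (b hq) \bo b hq) u (r, m, k) = (P.[Q ^+ r])%:C * u (r, m, k).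
Proof.
have bbE n : opexp (adj (b hq) \bo b hq) n u (r, m, k) =
    (Q ^+ (r * n))%:C * u (r, m, k).
  rewrite adj_bE; elim: n => [|n IHn]; first by rewrite muln0 expr0 mul1r.
  rewrite opexpS [LHS]/= addrK IHn !mulrA -!rmorphM mulnS.
  by congr (_%:C * _); rewrite -!exprM -!exprD; congr (_ ^+ _); lia.
rewrite horner_coef rmorph_sum mulr_suml /oppoly bop_sumE.
have -> : (\sum_(i < size P) ((P`_i)%:C *: opexp (adj (b hq) \bo b hq) i) u) (r, m, k) =
   \sum_(i < size P) (P`_i)%:C * opexp (adj (b hq) \bo b hq) i u (r, m, k).
  by elim/big_rec2: _ => // i x y _ <-.
by apply: eq_bigr => i _; rewrite bbE exprM mulrA -rmorphM.
Qed.

Lemma L0E u p m k : L0 hq u (p, m, k) =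
  (nat_ext (fun r => Num.sqrt (qpoch_inf (q ^+ (2 * r + 2)) Q)) p)%:C * u (absz p, m, k).
Proof. by case: p => r. Qed.

(** The powers of v only translate p, L_0+ kills negative positions, powers of b or b^* translate k,
    and the polynomial in b^* b is diagonal. *)
Lemma is_shift_Gn n i j :
  is_shift (Gn hq n i j) (G_coef i j) (n + i%:Z + j%:Z) (j%:Z - i%:Z).
Proof.
move=> u p m k; rewrite [LHS]uexpz_vE /G /G_coef.
case: leqP => ij.
  rewrite bopZE ell2ZE.
  set P := oppoly _ _.
  rewrite -[X in _ * X]/(opexp v (j + i) (L0 hq (opexp (b hq) (j - i) (P u))) (p + n, m, k)).
  rewrite opexp_vE L0E opexp_bE oppoly_bE.
  have -> : p + n + (j + i)%:Z = p + (n + i%:Z + j%:Z) by lia.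
  have -> : j%:Z - i%:Z = (j - i)%N by lia.
  case: (p + _) => r; last by rewrite /= !mul0r mulr0.
  (* The scalar q^(i(i-j)) has exponent -i(j-i), the inverse power kept in [wall_coef]. *)
  rewrite /= !mulrA -!rmorphM; congr (_%:C * _); rewrite /wall_coef subnKC//.
  have -> : i%:Z * (i%:Z - j%:Z) = - (i * (j - i))%N%:Z.
    by rewrite PoszM -subzn// -mulrN opprB.
  by rewrite -exprnN -!mulrA invfM; ring.
rewrite bopZE ell2ZE.
set P := oppoly _ _.
rewrite -[X in _ * X]/(opexp v (i + j) (L0 hq
  (opexp ((- q)%:C *: adj (b hq)) (i - j) (P u))) (p + n, m, k)).
rewrite opexp_vE L0E opexp_adj_bE oppoly_bE.
have -> : p + n + (i + j)%:Z = p + (n + i%:Z + j%:Z) by lia.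
have -> : k - (j%:Z - i%:Z) = k + (i - j)%N by lia.
case: (p + _) => r; last by rewrite /= !mul0r mulr0.
rewrite /= !mulrA -!rmorphM; congr (_%:C * _); rewrite /wall_coef subnKC ?(ltnW ij)//.
have -> : j%:Z * (j%:Z - i%:Z) = - (j * (i - j))%N%:Z.
  by rewrite PoszM -subzn 1?ltnW// -mulrN opprB.
by rewrite -exprnN -!mulrA invfM; ring.
Qed.

End matrix_coefficients.

Theorem proposition8p9 (R : realType) (q : R) (hq : 0 < q < 1)
    (phi0 : bop R idxN idxN -> \bar R) (hphi0 : is_phi0 q phi0)
    (m n : int) (i j k l : nat) :
  weight_at (@Linf_Eq2 R) phi0 (Gn hq n i j \bo adj (Gn hq m k l))
    ((m == n)%:R * (i == k)%:R * (j == l)%:R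
       * (1 / q ^ (2 * n + 2 * j%:Z))%:C).
Proof.
have q0 : q != 0 by case/andP: hq => /gt_eqF ->.
pose a := n + i%:Z + j%:Z; pose d := j%:Z - i%:Z.
pose a' := m + k%:Z + l%:Z; pose d' := l%:Z - k%:Z.
have sX := is_shift_Gn hq n i j; have sY := is_shift_Gn hq m k l.
have hX := is_adjoint_shift (bounded_G_coef hq i j) sX.
have hY := is_adjoint_shift (bounded_G_coef hq k l) sY.
rewrite (adj_eq hY).
(* Indicator that the product is diagonal in the first leg and carries no power of S; otherwise
   every truncation has weight 0. *)
pose e : R := (a == a')%:R * (d - d' == 0)%:R.
have e_sym : e = (a' == a)%:R * (d' - d == 0)%:R.
  by rewrite /e eq_sym; congr (_ * _%:R); apply/eqP/eqP; lia.
pose term (c : int) r := q ^ (2 * (r%:Z - c)).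
have termE c r : term c r = (q ^+ 2) ^+ r * q ^ (- (2 * c)).
  rewrite /term mulrBr expfzDr// (_ : 2 * r%:Z = (2 * r)%N); last by lia.
  by rewrite -exprnP exprM.
have bdd (A : pred nat) c : bounded_seq c -> bounded_seq (fun r => (A r)%:R * c r).
  move=> bc; apply: bounded_seqM => //.
  by exists 1 => r; case: (A r); rewrite ?normr1 ?normr0.
have cvg_term i' j' k' l' c : j'%:Z - i'%:Z = l'%:Z - k'%:Z ->
    (\sum_(r < N) G_coef q i' j' r * G_coef q k' l' r * term c r @[N --> \oo]
      --> (i' == k')%:R * (q ^+ 2) ^+ i' * q ^ (- (2 * c)))%classic.
  move=> h; rewrite (_ : (fun N => _) = (fun N =>
    (\sum_(r < N) G_coef q i' j' r * G_coef q k' l' r * (q ^+ 2) ^+ r) * q ^ (- (2 * c)))).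
    by apply: cvgMr_tmp; exact: cvg_G_coefM.
  apply/funext => N; rewrite mulr_suml; apply: eq_bigr => r _.
  by rewrite termE mulrA.
pose lev (t : idxSU) := t.1.1.
have [hnsf _] := hphi0.
have MLinf i' j' k' l' (c1 d1 c2 d2 : int) X (A : pred nat) :
    is_shift X (G_coef q i' j') c1 d1 ->
    Linf_Eq2 (X \bo cproj (A \o lev) \bo shift_adj (bounded_G_coef hq k' l') c2 d2).
  move=> sX'; have h := is_band_piece (bounded_G_coef hq k' l') c2 d2 A sX'.
  by apply: Linf_band h; apply: bdd; apply: bounded_seqM; exact: bounded_G_coef.
pose sq i' j' c N := \sum_(r < N) G_coef q i' j' r * G_coef q i' j' r * term c r.
pose cross N := \sum_(r < N) G_coef q i j r * G_coef q k l r * (e * term a r).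
have below_weight i' j' k' l' (c1 d1 c2 d2 : int) X N :
    is_shift X (G_coef q i' j') c1 d1 ->
    weight_at (@Linf_Eq2 R) phi0
      (X \bo cproj (fun t => lev t < N)%N \bo shift_adj (bounded_G_coef hq k' l') c2 d2)
      (\sum_(r < N) G_coef q i' j' r * G_coef q k' l' r *
        ((c1 == c2)%:R * (d1 - d2 == 0)%:R * term c1 r))%:C.
  move=> sX'.
  have h := is_band_piece (bounded_G_coef hq k' l') c2 d2 (fun r => r < N)%N sX'.
  exact: weight_band hphi0 h.
(* X Y^* and Y X^* have equal truncated weights: a and a' differ only when [e] vanishes. *)
have crossE N : cross N = \sum_(r < N) G_coef q k l r * G_coef q i j r *
    ((a' == a)%:R * (d' - d == 0)%:R * term a' r).
  apply: eq_bigr => r _; rewrite -e_sym (mulrC (G_coef q k l r)).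
  by rewrite /e; case: (eqVneq a a') => [->//|_]; rewrite !mul0r.
have -> : (m == n)%:R * (i == k)%:R * (j == l)%:R * (1 / q ^ (2 * n + 2 * j%:Z))%:C =
    (e * ((i == k)%:R * (q ^+ 2) ^+ i * q ^ (- (2 * a))))%:C :> R[i].
  transitivity ((m == n)%:R * (i == k)%:R * (j == l)%:R * (1 / q ^ (2 * n + 2 * j%:Z)))%:C.
    by rewrite !(rmorphM (real_complex R)) !rmorph_nat.
  congr _%:C.
  (* Given i = k, the condition d = d' means j = l, and then a = a' means m = n. *)
  have -> : (m == n)%:R * (i == k)%:R * (j == l)%:R = e * (i == k)%:R :> R.
    rewrite /e -!natrM !mulnb; congr (_%:R); congr nat_of_bool; lia.
  rewrite -!mulrA; congr (_ * _).
  rewrite -exprM exprnP -expfzDr// div1r invr_expz.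
  by have -> : - (2 * n + 2 * j%:Z) = (2 * i)%N%:Z - 2 * a by lia.
apply: (@weight_polarization R _ _ (@Linf_Eq2 R) phi0 hnsf (@Linf_Eq2D R) (@Linf_Eq2Z R)
  _ _ _ _ hX hY lev _ _ _ _ (sq i j a) (sq k l a') cross).
- by move=> A; exact: MLinf sX.
- by move=> A; exact: MLinf sX.
- by move=> A; exact: MLinf sY.
- by move=> A; exact: MLinf sY.
- move=> N; have := below_weight i j i j a d a d _ N sX.
  by under eq_bigr do rewrite eqxx subrr eqxx !mul1r.
- move=> N; have := below_weight k l k l a' d' a' d' _ N sY.
  by under eq_bigr do rewrite eqxx subrr eqxx !mul1r.
- by move=> N; exact: below_weight sX.
- by move=> N; rewrite crossE; exact: below_weight sY.
- exact: cvg_term.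
- exact: cvg_term.
- have -> : cross = (fun N => e * \sum_(r < N) G_coef q i j r * G_coef q k l r * term a r).
    by apply/funext => N; rewrite mulr_sumr; apply: eq_bigr => r _; rewrite mulrCA.
  (* Orthogonality is available only for d = d'; otherwise e = 0 and the sequence is constantly
     zero. *)
  have [dd|dd] := eqVneq (d - d') 0.
    by apply: cvgMl_tmp; apply: cvg_term; apply/eqP; rewrite -subr_eq0; apply/eqP.
  have -> : e = 0 by rewrite /e (negbTE dd) mulr0.
  rewrite mul0r (_ : (fun N => _) = (fun=> 0)); first exact: cvg_cst.
  by apply/funext => N; rewrite mul0r.
Qed.
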